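(* Let $K$ be a perfect field of characteristic $p\ge0$, let $n\ge1$, and let $\mathbb{X}$ be a 0-dimensional locally monomial Gorenstein scheme (LMG-scheme) in $\mathbb{P}^n_K$ with support $\operatorname{Supp}(\mathbb{X})=\{p_1,\dots,p_s\}$, no point of which lies on the hyperplane $X_0=0$, and with homogeneous coordinate ring $R$. Let $A=K[X_1,\dots,X_n]$. For $j=1,\dots,s$ write $\mathcal{O}_j\cong A/\mathfrak{Q}_j$, where $\mathcal{O}_j$ is the local ring of $\mathbb{X}$ at $p_j$ and $\mathfrak{Q}_j=\langle X_1^{k_{1j}},\dots,X_n^{k_{nj}}\rangle$ with $k_{ij}\ge1$. Then $$ \operatorname{HP}(\Omega^1_R)=\sum_{j=1}^s\Big[(n+1)\,k_{1j}\cdots k_{nj}-\sum_{\substack{1\le i\le n\\ p\nmid k_{ij}}}k_{1j}\cdots\widehat{k_{ij}}\cdots k_{nj}\Big], $$ where $\widehat{k_{ij}}$ means that the factor $k_{ij}$ is omitted from the product.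
   Context: $P=K[X_0,\dots,X_n]$ is standard graded, $I_{\mathbb{X}}$ is the saturated homogeneous ideal of $P$ defining the 0-dimensional (closed sub)scheme $\mathbb{X}$, and $R=P/I_{\mathbb{X}}$. $\operatorname{Supp}(\mathbb{X})$ is the set of closed points of $\mathbb{X}$. Since the support avoids $X_0=0$, $\mathbb{X}$ is a subscheme of $\mathbb{A}^n_K$ with affine vanishing ideal $J_{\mathbb{X}}\subseteq A$, the dehomogenization of $I_{\mathbb{X}}$ with respect to $X_0$; $J_{\mathbb{X}}=J_{p_1}\cap\cdots\cap J_{p_s}$ is its primary decomposition, and $\mathcal{O}_j=A/J_{p_j}$ is the local ring of $\mathbb{X}$ at $p_j$. $\mathbb{X}$ is a locally monomial scheme if for each $j$ there is a linear change of coordinates $\varphi_j:A\to A$ (translations allowed, i.e. a $K$-algebra automorphism sending each $X_i$ to a polynomial of degree $1$) such that $\mathfrak{Q}_j=\varphi_j(J_{p_j})$ is a monomial ideal of $A$. It is a locally monomial Gorenstein scheme (LMG-scheme) if moreover all local rings $\mathcal{O}_j\cong A/\mathfrak{Q}_j$ are Gorenstein; then each $\mathfrak{Q}_j$ is of the form $\langle X_1^{k_{1j}},\dots,X_n^{k_{nj}}\rangle$ with positive integers $k_{ij}$. $\Omega^1_R=\Omega^1_{R/K}$ is the graded module of Kähler differentials of $R/K$ (with $\deg(dx_i)=1$, $x_i$ the image of $X_i$), and $\operatorname{HP}$ denotes its Hilbert polynomial, which is constant and identified with an integer. Convention: if $p=0$, then $p\nmid k$ for all $k\ge1$. *)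

(* Defs.v *)
From HB Require Import structures.
From mathcomp Require Import all_boot all_algebra ring_quotient.
From mathcomp Require Import boolp.
From mathcomp.multinomials Require Import freeg mpoly.

Set Implicit Arguments.
Unset Strict Implicit.
Unset Printing Implicit Defensive.

Import GRing.Theory.

Local Open Scope ring_scope.
Local Open Scope quotient_scope.

(* MathComp's [idealr R] is the type of PROPER ideals of R, so the empty
   scheme is excluded by typing and every quotient {ideal_quot I} is a nonzero
   ring. *)

Definition perfect_field (K : fieldType) : Prop :=
  forall p : nat, p \in [pchar K] -> forall x : K, exists y : K, y ^+ p = x.

Definition has_characteristic (K : fieldType) (p : nat) : Prop :=
  if p == 0%N then [pchar K] =i pred0 else p \in [pchar K].

Section SubmoduleSpan.
Variables (R : comNzRingType) (M : lmodType R) (S : M -> Prop).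

Definition submod_span : {pred M} := fun w =>
  `[< exists2 s : seq (R * M),
        {in s, forall x, S x.2} & w = \sum_(x <- s) x.1 *: x.2 >].

Lemma submod_span_closed : submod_closed submod_span.
Proof.
split=> [|a u v]; first by apply/asboolP; exists [::] => //; rewrite big_nil.
move=> /asboolP[su Su ->] /asboolP[sv Sv ->]; apply/asboolP.
exists ([seq (a * x.1, x.2) | x <- su] ++ sv).
  move=> x; rewrite mem_cat => /orP[/mapP[y ys ->]|xs]; first exact: (Su y).
  exact: Sv.
rewrite big_cat big_map scaler_sumr; congr (_ + _).
by apply: eq_bigr => x _; rewrite scalerA.
Qed.

Lemma submod_span_zmod_closed : zmod_closed submod_span.
Proof.
split=> [|u v Su Sv]; first exact: submod_span_closed.1.
by rewrite addrC -scaleN1r; apply: submod_span_closed.2.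
Qed.

HB.instance Definition _ :=
  GRing.isZmodClosed.Build M submod_span submod_span_zmod_closed.

Lemma submod_spanZ a w : w \in submod_span -> a *: w \in submod_span.
Proof.
by move=> Sw; rewrite -[_ *: _]addr0 submod_span_closed.2 ?rpred0.
Qed.

Lemma mem_submod_span w : S w -> w \in submod_span.
Proof.
move=> Sw; apply/asboolP; exists [:: (1, w)]; last by rewrite big_seq1 scale1r.
by move=> x; rewrite inE => /eqP->.
Qed.

End SubmoduleSpan.

Section QuotientModule.
Variables (R : comNzRingType) (M : lmodType R) (S : M -> Prop).

Definition quotmod : Type := {ideal_quot (submod_span S)}.

HB.instance Definition _ := GRing.Zmodule.on quotmod.

Definition quotmod_proj : M -> quotmod := \pi_{ideal_quot (submod_span S)}.

Definition quotmod_repr (w : quotmod) : M :=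
  repr (w : {ideal_quot (submod_span S)}).

Lemma quotmod_reprK w : quotmod_proj (quotmod_repr w) = w.
Proof. exact: (@reprK _ {ideal_quot (submod_span S)}). Qed.

Lemma quotmod_eqP u v :
  reflect (quotmod_proj u = quotmod_proj v) (u - v \in submod_span S).
Proof. by rewrite Quotient.idealrBE; apply: eqP. Qed.

Lemma quotmod_projB : zmod_morphism quotmod_proj.
Proof. exact: pi_is_zmod_morphism. Qed.

HB.instance Definition _ :=
  GRing.isZmodMorphism.Build M quotmod quotmod_proj quotmod_projB.

Definition quotmod_scale (a : R) (w : quotmod) : quotmod :=
  quotmod_proj (a *: quotmod_repr w).

Lemma quotmod_scaleE a u :
  quotmod_scale a (quotmod_proj u) = quotmod_proj (a *: u).
Proof.
apply/quotmod_eqP; rewrite -scalerBr; apply: submod_spanZ.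
by apply/quotmod_eqP; rewrite quotmod_reprK.
Qed.

Lemma quotmod_scaleA a b w :
  quotmod_scale a (quotmod_scale b w) = quotmod_scale (a * b) w.
Proof. by rewrite -[w]quotmod_reprK !quotmod_scaleE scalerA. Qed.

Lemma quotmod_scale1 : left_id 1 quotmod_scale.
Proof. by move=> w; rewrite -[w]quotmod_reprK !quotmod_scaleE scale1r. Qed.

Lemma quotmod_scaleDr : right_distributive quotmod_scale +%R.
Proof.
move=> a u v; rewrite -[u]quotmod_reprK -[v]quotmod_reprK.
by rewrite -raddfD !quotmod_scaleE scalerDr raddfD.
Qed.

Lemma quotmod_scaleDl w : {morph quotmod_scale^~ w : a b / a + b}.
Proof.
move=> a b; rewrite -[w]quotmod_reprK.
by rewrite !quotmod_scaleE scalerDl raddfD.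
Qed.

HB.instance Definition _ := GRing.Zmodule_isLmodule.Build R quotmod
  quotmod_scaleA quotmod_scale1 quotmod_scaleDr quotmod_scaleDl.

Lemma quotmod_projZ : scalable quotmod_proj.
Proof. by move=> a w; rewrite -quotmod_scaleE. Qed.

HB.instance Definition _ :=
  GRing.isScalable.Build R M quotmod *:%R quotmod_proj quotmod_projZ.

End QuotientModule.

Section Derivation.
Variables (K R : comNzRingType) (f : {rmorphism K -> R}).

Definition is_derivation (M : lmodType R) (D : R -> M) : Prop :=
  [/\ forall a b, D (a + b) = D a + D b,
      forall a b, D (a * b) = a *: D b + b *: D a
    & forall c, D (f c) = 0].

(* Omega^1_{R/K} is the free R-module on the symbols << a >> (standing for
   da, a in R) modulo the relations making d a K-linear derivation, where R is
   a K-algebra through f. *)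
Inductive kaehler_relation : {freeg R / R} -> Prop :=
| KaehlerAdd a b : kaehler_relation (<< a + b >> - (<< a >> + << b >>))
| KaehlerMul a b :
    kaehler_relation (<< a * b >> - (a *: << b >> + b *: << a >>))
| KaehlerConst c : kaehler_relation << f c >>.

Definition kaehler : Type := quotmod kaehler_relation.

HB.instance Definition _ := GRing.Lmodule.on kaehler.

Definition kaehler_d (a : R) : kaehler :=
  quotmod_proj kaehler_relation << a >>.

Lemma kaehler_d_derivation : is_derivation kaehler_d.
Proof.
split=> [a b|a b|c].
- rewrite /kaehler_d -raddfD; apply/quotmod_eqP/mem_submod_span.
  exact: KaehlerAdd.
- rewrite /kaehler_d -!linearZ -raddfD; apply/quotmod_eqP/mem_submod_span.
  exact: KaehlerMul.
- rewrite /kaehler_d -(raddf0 (quotmod_proj kaehler_relation)).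
  by apply/quotmod_eqP/mem_submod_span; rewrite subr0; apply: KaehlerConst.
Qed.

Lemma kaehler_universal (M : lmodType R) (D : R -> M) :
  is_derivation D ->
  exists phi : {linear kaehler -> M},
    (forall a, phi (kaehler_d a) = D a) /\
    (forall psi : {linear kaehler -> M},
       (forall a, psi (kaehler_d a) = D a) -> psi =1 phi).
Proof.
case=> DD DM DK; pose L : {freeg R / R} -> M := fglift D.
have LU k a : L (<< k *g a >>) = k *: D a by exact: liftU.
have LB : zmod_morphism L by exact: lift_is_additive.
pose La : {additive _ -> M} :=
  HB.pack L (GRing.isZmodMorphism.Build _ _ L LB).
have L0 : L 0 = 0 by exact: (raddf0 La).
have LD u v : L (u + v) = L u + L v by exact: (raddfD La).
have LZ a w : L (a *: w) = a *: L w.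
  elim/freeg_ind_dom0: w => [|k x w _ _ IH]; first by rewrite scaler0 L0 scaler0.
  have -> : a *: (<< k *g x >> + w) = << (a * k) *g x >> + a *: w.
    rewrite scalerDr; congr (_ + _); apply/eqP/freeg_eqP => y.
    by rewrite coeffZ !coeffU mulrA.
  by rewrite !LD !LU IH scalerDr scalerA.
have L_rel w : w \in submod_span kaehler_relation -> L w = 0.
  move=> /asboolP[s Ss ->].
  rewrite (big_morph L LD L0) big_seq big1 // => x xs.
  rewrite LZ; suff -> : L x.2 = 0 by rewrite scaler0.
  case: (Ss _ xs) => [a b|a b|c].
  - by rewrite LB LD !LU !scale1r DD subrr.
  - by rewrite LB LD !LZ !LU !scale1r DM subrr.
  - by rewrite LU DK scaler0.
pose phi (w : kaehler) := L (quotmod_repr w).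
have phiE u : phi (quotmod_proj kaehler_relation u) = L u.
  apply/eqP; rewrite -subr_eq0 -LB; apply/eqP/L_rel.
  by apply/quotmod_eqP; rewrite quotmod_reprK.
have phiB : zmod_morphism phi.
  move=> u v; rewrite -[u]quotmod_reprK -[v]quotmod_reprK.
  by rewrite -raddfB !phiE LB.
have phiZ : scalable phi.
  move=> a u; rewrite -[u]quotmod_reprK.
  by rewrite -[_ *: quotmod_proj _ _]linearZ !phiE LZ.
pose phiL : {linear kaehler -> M} :=
  HB.pack phi (GRing.isZmodMorphism.Build _ _ phi phiB)
              (GRing.isScalable.Build _ _ _ _ phi phiZ).
exists phiL; split=> [a|psi psiD w]; first by rewrite /= phiE LU scale1r.
rewrite -[w]quotmod_reprK /= phiE.
elim/freeg_ind_dom0: (quotmod_repr w) => [|k x u _ _ IH].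
  by rewrite raddf0 raddf0 L0.
rewrite !raddfD /= IH LD LU; congr (_ + _).
have -> : << k *g x >> = k *: << x >> :> {freeg R / R}.
  by apply/eqP/freeg_eqP => y; rewrite coeffZ !coeffU mul1r.
by rewrite !linearZ /= psiD.
Qed.

End Derivation.

Section Hilbert.
Variables (K R : comNzRingType) (f : {rmorphism K -> R}) (M : lmodType R).

(* The scalar c : K acts on M as f c.  b is a K-basis of V. *)
Definition has_dimension (V : M -> Prop) (h : nat) : Prop :=
  exists b : 'I_h -> M,
    (forall w, V w <-> exists c : 'I_h -> K, w = \sum_i f (c i) *: b i) /\
    (forall c : 'I_h -> K,
       \sum_i f (c i) *: b i = 0 -> forall i, c i = 0).

(* gr d is the homogeneous component of degree d of M. *)
Definition is_hilbert_polynomial (gr : nat -> M -> Prop) (q : {poly rat}) :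
    Prop :=
  exists d0 : nat, forall d : nat, (d0 <= d)%N ->
    exists2 h : nat, has_dimension (gr d) h & q.[d%:R] = h%:R.

End Hilbert.

Section Ideals.
Variable R : comNzRingType.

Definition in_radical (Q : {pred R}) (a : R) : Prop :=
  exists k : nat, a ^+ k \in Q.

Definition is_primary (Q : idealr R) : Prop :=
  forall a b, a * b \in Q -> a \in Q \/ in_radical Q b.

Definition ideal_generated (S : R -> Prop) (a : R) : Prop :=
  exists2 s : seq (R * R),
    {in s, forall x, S x.2} & a = \sum_(x <- s) x.1 * x.2.

Definition is_maximal (m : idealr R) : Prop :=
  forall m' : idealr R, {subset m <= m'} -> {subset m' <= m}.

Definition in_socle (m : idealr R) (a : R) : Prop :=
  forall b, b \in m -> b * a = 0.

(* A 0-dimensional local ring is Gorenstein when its socle has dimension one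
   over the residue field.  The socle is killed by the maximal ideal, so that
   is: it is nonzero and generated by one element. *)
Definition gorenstein_local : Prop :=
  exists m : idealr R,
    [/\ is_maximal m,
        forall m' : idealr R, is_maximal m' -> m' =i m
      & exists a : R,
          [/\ a != 0, in_socle m a
            & forall b, in_socle m b -> exists c, b = c * a]].

End Ideals.

Section Projective.
Variables (K : fieldType) (n : nat).
Local Notation P := {mpoly K[n.+1]}.
Local Notation A := {mpoly K[n]}.

Definition homogeneous_ideal (I : {pred P}) : Prop :=
  forall d f, f \in I -> pihomog mdeg d f \in I.

Definition saturated_ideal (I : {pred P}) : Prop :=
  forall f, (exists N, forall m : 'X_{1..n.+1},
               mdeg m = N -> 'X_[m] * f \in I) -> f \in I.

(* Points of Proj(P/I), as relevant homogeneous primes of P. *)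
Definition scheme_point (I : idealr P) (q : prime_idealr P) : Prop :=
  [/\ homogeneous_ideal q, {subset I <= q} & exists i, 'X_i \notin q].

Definition closed_point (I : idealr P) (q : prime_idealr P) : Prop :=
  scheme_point I q /\
  forall q' : prime_idealr P,
    scheme_point I q' -> {subset q <= q'} -> {subset q' <= q}.

(* The underlying topological space of the subscheme is nonempty and has no
   proper specialization. *)
Definition zero_dimensional (I : idealr P) : Prop :=
  (exists q, scheme_point I q) /\
  forall q, scheme_point I q -> closed_point I q.

Definition enumerates_support (I : idealr P) (s : nat)
    (pt : 'I_s -> prime_idealr P) : Prop :=
  [/\ forall j, closed_point I (pt j),
      forall j j', pt j =i pt j' -> j = j'
    & forall q, closed_point I q -> exists j, q =i pt j].

(* Dehomogenization with respect to X_0: the variables of P are X_0, ..., X_n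
   and those of A are X_1, ..., X_n, so X_i of P becomes the variable of A of
   index i - 1. *)
Definition dehomog (f : P) : A :=
  f \mPo [tuple if unlift ord0 i is Some j then 'X_j else 1 | i < n.+1].

Definition dehomog_ideal (I : {pred P}) (g : A) : Prop :=
  exists2 f, f \in I & dehomog f = g.

(* J j is the primary component of the dehomogenized ideal at pt j. *)
Definition is_primary_decomposition (I : idealr P) (s : nat)
    (pt : 'I_s -> prime_idealr P) (J : 'I_s -> idealr A) : Prop :=
  [/\ forall j, is_primary (J j),
      forall j g, in_radical (J j) g <-> dehomog_ideal (pt j) g
    & forall g, dehomog_ideal I g <-> forall j, g \in J j].

Definition linear_change (phi : {lrmorphism A -> A}) : Prop :=
  bijective phi /\ forall i, msize (phi 'X_i) = 2%N.

(* phi maps J onto the ideal generated by S. *)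
Definition maps_onto (phi : {lrmorphism A -> A}) (J : idealr A)
    (S : A -> Prop) : Prop :=
  forall g, (exists2 f, f \in J & phi f = g) <-> ideal_generated S g.

Definition locally_monomial (s : nat) (J : 'I_s -> idealr A) : Prop :=
  forall j, exists2 phi : {lrmorphism A -> A}, linear_change phi &
    exists S : {pred 'X_{1..n}},
      maps_onto phi (J j) (fun g => exists2 m, m \in S & g = 'X_[m]).

(* The local ring at the j-th point is A / J j. *)
Definition locally_monomial_gorenstein (s : nat) (J : 'I_s -> idealr A) :
    Prop :=
  locally_monomial J /\ forall j, gorenstein_local {ideal_quot (J j)}.

Definition pure_powers (k : 'I_n -> nat) (g : A) : Prop :=
  exists i, g = 'X_i ^+ k i.

Definition coord_ring (I : idealr P) : comNzRingType := {ideal_quot I}.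

Definition coord_proj (I : idealr P) : {rmorphism P -> coord_ring I} :=
  \pi_{ideal_quot I}.

Definition coord_const (I : idealr P) : {rmorphism K -> coord_ring I} :=
  coord_proj I \o @mpolyC n.+1 K.

Definition Omega1 (I : idealr P) : lmodType (coord_ring I) :=
  kaehler (coord_const I).

(* Grading of Omega^1_R with deg(dx_i) = 1. *)
Definition Omega1_component (I : idealr P) (d : nat) (w : Omega1 I) : Prop :=
  if d is e.+1 then
    exists2 r : 'I_n.+1 -> P, forall i, r i \is e.-homog &
      w = \sum_i coord_proj I (r i)
                   *: kaehler_d (coord_const I) (coord_proj I 'X_i)
  else w = 0.

Definition Omega1_hilbert_polynomial (I : idealr P) : {poly rat} -> Prop :=
  is_hilbert_polynomial (coord_const I) (@Omega1_component I).

End Projective.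

(* Main.v *)
(* Dehomogenization identifies R_d, for d large, with B = A/J, which is the
   product of the local rings B_j = A/J_j.  Writing omega r for the sum of the
   r_l dX_l, Euler's formula turns the relations omega (grad f) = 0, f in I,
   into relations on A^(n+1), so that Omega_d is B + Omega_B for d large.  Over
   B_j, after the change of coordinates phi_j, Omega_B becomes the sum over i of
   A/<X^k, k_i X_i^(k_i - 1)>, whose monomial basis is a box.  Reading off the
   coefficients on these boxes gives explicit linear functionals on Omega_d.
   They are well defined by the universal property and jointly surjective by the
   Chinese remainder theorem; a common zero integrates to some g in J, which
   only shows that it is killed by a power of X_0.  Since X_0 maps Omega_d onto
   Omega_(d+1) for d large, the number of generators stabilises, and then
   multiplication by X_0 is also injective, so the functionals are coordinates. *)

Require Import Defs.
From HB Require Import structures.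
From mathcomp Require Import all_boot all_algebra ring_quotient.
From mathcomp Require Import boolp.
From mathcomp Require classical_sets.
From mathcomp.multinomials Require Import freeg mpoly.
From mathcomp Require Import ring.

Set Implicit Arguments.
Unset Strict Implicit.
Unset Printing Implicit Defensive.

Import GRing.Theory.

Local Open Scope ring_scope.

(** * Ideals as propositional predicates *)

Section IdealPredicates.
Variable R : comNzRingType.
Implicit Type U : R -> Prop.

(** Unlike [idealr], this admits the unit ideal, which does occur: a box with an empty side gives
    it. *)
Definition ideal_pred U : Prop :=
  [/\ U 0, forall u v, U u -> U v -> U (u + v) & forall a u, U u -> U (a * u)].

Lemma ideal_pred_sum U (T : eqType) (s : seq T) (P : pred T) (F : T -> R) :
  ideal_pred U -> (forall x, x \in s -> P x -> U (F x)) ->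
  U (\sum_(x <- s | P x) F x).
Proof.
move=> [U0 UD _] UF; rewrite big_seq_cond.
apply: (big_ind U) => // x /andP[xs Px]; exact: UF.
Qed.

Lemma ideal_predN U u : ideal_pred U -> U u -> U (- u).
Proof. by case=> _ _ UM Uu; rewrite -mulN1r; apply: UM. Qed.

Lemma ideal_predB U u v : ideal_pred U -> U u -> U v -> U (u - v).
Proof. by move=> UI Uu Uv; have [_ UD _] := UI; apply: UD => //; apply: ideal_predN. Qed.

Lemma ideal_predMr U a u : ideal_pred U -> U u -> U (u * a).
Proof. by case=> _ _ UM Uu; rewrite mulrC; apply: UM. Qed.

Lemma ideal_pred_generated (S : R -> Prop) : ideal_pred (ideal_generated S).
Proof.
split=> [|u v [su Su ->] [sv Sv ->]|a u [s Ss ->]].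
- by exists [::] => //; rewrite big_nil.
- exists (su ++ sv); last by rewrite big_cat.
  by move=> x; rewrite mem_cat => /orP[/Su|/Sv].
- exists [seq (a * x.1, x.2) | x <- s].
    by move=> x /mapP[y /Ss Sy ->].
  by rewrite big_map mulr_sumr; apply: eq_bigr => x _; rewrite mulrA.
Qed.

Lemma ideal_generated_mem (S : R -> Prop) u : S u -> ideal_generated S u.
Proof.
move=> Su; exists [:: (1, u)]; last by rewrite big_seq1 mul1r.
by move=> x; rewrite inE => /eqP->.
Qed.

Lemma ideal_generated_sub (S U : R -> Prop) :
  ideal_pred U -> (forall u, S u -> U u) -> forall u, ideal_generated S u -> U u.
Proof.
move=> UI SU u [s Ss ->]; apply: ideal_pred_sum => // x xs _.
by case: UI => _ _; apply; apply/SU/Ss.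
Qed.

End IdealPredicates.

Lemma ideal_pred_preim (R R' : comNzRingType) (th : {rmorphism R -> R'})
    (U : R' -> Prop) :
  ideal_pred U -> ideal_pred (fun f => U (th f)).
Proof.
case=> U0 UD UM; split=> [|u v|a u]; first by rewrite rmorph0.
  by rewrite rmorphD; apply: UD.
by rewrite rmorphM; apply: UM.
Qed.

(** * Derivatives and homogeneous components of polynomials *)

Section MpolyGeneral.
Variable K : fieldType.

Lemma mpoly_alg_ind n (Q : {mpoly K[n]} -> Prop) :
  (forall c, Q c%:MP) -> (forall i, Q 'X_i) ->
  (forall u v, Q u -> Q v -> Q (u + v)) ->
  (forall u v, Q u -> Q v -> Q (u * v)) ->
  forall f, Q f.
Proof.
move=> QC QX QD QM f; have Q0 : Q 0 by rewrite -mpolyC0.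
have Q1 : Q 1 by rewrite -mpolyC1.
rewrite [f]mpolyE; apply: (big_ind Q) => // m _; rewrite -mul_mpolyC.
apply: (QM) => //; rewrite mpolyXE_id; apply: (big_ind Q) => // i _.
by elim: (m i) => [|a IH]; rewrite ?expr0 // exprS; apply: QM.
Qed.

Lemma mderiv1 n i : (1 : {mpoly K[n]})^`M(i) = 0.
Proof. by rewrite -mpolyC1 mderivC. Qed.

Lemma mderivXU n (i l : 'I_n) : ('X_l : {mpoly K[n]})^`M(i) = (l == i)%:R.
Proof.
rewrite mderivX mnm1E; case: eqVneq => [->|_]; last by rewrite scale0r.
rewrite scale1r -[X in (X - _)%MM]addm0 [(_ + 0)%MM]addmC addmK mpolyX0 //.
Qed.

Lemma mderivXn n i (u : {mpoly K[n]}) e :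
  (u ^+ e.+1)^`M(i) = (e.+1)%:R * (u ^+ e * u^`M(i)).
Proof.
elim: e => [|e IH]; first by rewrite expr1 expr0 !mul1r.
rewrite exprS mderivM IH -[in RHS]natr1 mulrDl mul1r addrC.
by rewrite [_^`M(i) * _]mulrC mulrCA [u * (_ * _)]mulrA -exprS.
Qed.

Lemma lrmorphC m n (th : {lrmorphism {mpoly K[m]} -> {mpoly K[n]}}) c :
  th c%:MP = c%:MP.
Proof. by rewrite -[c%:MP]mulr1 mul_mpolyC linearZ rmorph1 /= -mul_mpolyC mulr1. Qed.

(** Chain rule. Both sides are additive in [f] and obey the same product rule along [th], so
    constants and variables suffice. *)
Lemma mderiv_lrmorph m n (th : {lrmorphism {mpoly K[m]} -> {mpoly K[n]}})
    i f :
  (th f)^`M(i) = \sum_l th f^`M(l) * (th 'X_l)^`M(i).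
Proof.
elim/mpoly_alg_ind: f => [c|l|u v Hu Hv|u v Hu Hv].
- by rewrite lrmorphC mderivC big1 // => l _; rewrite mderivC rmorph0 mul0r.
- rewrite (bigD1 l) //= mderivXU eqxx rmorph1 mul1r big1 ?addr0 // => l' ne.
  by rewrite mderivXU eq_sym (negPf ne) rmorph0 mul0r.
- rewrite rmorphD mderivD Hu Hv -big_split; apply: eq_bigr => l _.
  by rewrite mderivD rmorphD mulrDl.
- rewrite rmorphM mderivM Hu Hv mulr_suml mulr_sumr -big_split.
  apply: eq_bigr => l _; rewrite mderivM rmorphD !rmorphM /=; ring.
Qed.

Lemma euler_homog n d (f : {mpoly K[n]}) : f \is d.-homog ->
  \sum_i 'X_i * f^`M(i) = d%:R * f.
Proof.
move=> /dhomogP fd; rewrite {2}[f]mpolyE mulr_sumr.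
have E i : 'X_i * f^`M(i) = \sum_(m <- msupp f) f@_m *: ('X_i * 'X_[m]^`M(i)).
  rewrite {1}[f]mpolyE raddf_sum mulr_sumr; apply: eq_bigr => m _.
  by rewrite /= mderivZ -scalerAr.
rewrite (eq_bigr _ (fun i _ => E i)) exchange_big /= big_seq [RHS]big_seq.
apply: eq_bigr => m mf; rewrite -scaler_sumr -scalerAr; congr (_ *: _).
rewrite -(fd m mf) /= mdegE natr_sum mulr_suml; apply: eq_bigr => i _.
rewrite mderivX -scalerAr -mul_mpolyC mpolyC_nat.
(* If [X_i] does not divide the monomial, the truncated difference [m - U_(i)] is meaningless, but
   its coefficient is zero. *)
have [->|mi0] := posnP (m i); first by rewrite !mul0r.
congr (_ * _); rewrite -mpolyXD; congr ('X_[_]); apply/mnmP => l.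
rewrite mnmDE mnmBE mnm1E; case: eqVneq => [<-|]; last by rewrite subn0.
by rewrite addnC subnK.
Qed.

Lemma homog_mpolyC n (c : K) : (c%:MP : {mpoly K[n]}) \is 0.-homog.
Proof. by rewrite -[c%:MP]mulr1 mul_mpolyC; apply/dhomogZ/dhomog1. Qed.

Lemma mderiv_homog n d i (f : {mpoly K[n]}) :
  f \is d.+1.-homog -> f^`M(i) \is d.-homog.
Proof.
move=> /dhomogP fd; apply/dhomogP => m; rewrite mcoeff_msupp mcoeff_mderiv => nz.
have: (m + U_(i))%MM \in msupp f.
  by rewrite mcoeff_msupp; apply: contraNneq nz => ->; rewrite mul0rn.
by move/fd; rewrite /= mdegD (mdeg1 i) addn1 => -[].
Qed.

Lemma homogX n (i : 'I_n) : ('X_i : {mpoly K[n]}) \is 1.-homog.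
Proof. by rewrite dhomogX /= mdeg1. Qed.

Lemma pihomogM n d e (u v : {mpoly K[n]}) : u \is e.-homog ->
  pihomog mdeg (e + d) (u * v) = u * pihomog mdeg d v.
Proof.
move=> ue; rewrite {1}(pihomog_partitionE (leqnn (msize v))) mulr_sumr raddf_sum.
rewrite (eq_bigr (fun i : 'I_(msize v) =>
   if i == d :> nat then u * pihomog mdeg i v else 0)); last first.
  move=> i _; have H : u * pihomog mdeg i v \is (e + i).-homog.
    exact: dhomogM ue (pihomogP _ _ _).
  case: eqVneq => [<-|ne]; first exact: pihomog_dE.
  by apply: pihomog_ne0 H; rewrite eqn_add2l.
rewrite -big_mkcond /=; case: (ltnP d (msize v)) => [lt|le].
  by rewrite (big_pred1 (Ordinal lt)).
rewrite big_pred0 => [|i]; last first.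
  by apply/negbTE; rewrite neq_ltn (leq_trans (ltn_ord i) le).
rewrite pihomogE big1_seq ?mulr0 // => m /andP[/eqP md /msize_mdeg_lt].
by rewrite md ltnNge le.
Qed.

End MpolyGeneral.

(** * Ideals generated by powers of the variables *)

Section Box.
Variables (K : fieldType) (n : nat).
Implicit Types (k : 'I_n -> nat) (f g : {mpoly K[n]}).

Definition in_box k (m : 'X_{1..n}) := [forall i, (m i < k i)%N].

(** The ideal [<X_1^(k_1), ..., X_n^(k_n)>] given by its standard monomials, so that coefficients in
    the box are functionals on the quotient. *)
Definition box_ideal k f : Prop := forall m, in_box k m -> f@_m = 0.

Lemma box_idealP k : ideal_pred (box_ideal k).
Proof.
split=> [m _|u v uk vk m mk|a u uk m mk]; first exact: mcoeff0.
  by rewrite mcoeffD uk ?vk ?addr0.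
rewrite mcoeffM big1 // => q /eqP mE; rewrite uk ?mulr0 //.
apply/forallP => i; apply: leq_ltn_trans (forallP mk i).
by rewrite (congr1 (fun m' : 'X_{1..n} => m' i) mE) mnmDE leq_addl.
Qed.

Lemma box_ideal_sub k k' f :
  (forall i, k' i <= k i)%N -> box_ideal k f -> box_ideal k' f.
Proof.
move=> le fk m /forallP mk; apply: fk; apply/forallP => i.
exact: leq_trans (mk i) (le i).
Qed.

Lemma box_ideal_mpolyX k i (m : 'X_{1..n}) : (k i <= m i)%N -> box_ideal k 'X_[m].
Proof.
move=> le m' /forallP m'k; rewrite mcoeffX; case: eqVneq => // E.
by have := m'k i; rewrite -E ltnNge le.
Qed.

Lemma mpolyXU_exp (i : 'I_n) e : 'X_i ^+ e = 'X_[U_(i) *+ e] :> {mpoly K[n]}.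
Proof. by rewrite mpolyXn. Qed.

Lemma box_ideal_power k i : box_ideal k ('X_i ^+ k i).
Proof.
by rewrite mpolyXU_exp; apply: (@box_ideal_mpolyX _ i); rewrite mulmnE mnm1E eqxx mul1n.
Qed.

Lemma mpolyX_divide i e (m : 'X_{1..n}) : (e <= m i)%N ->
  'X_[m] = 'X_[m - U_(i) *+ e] * 'X_i ^+ e :> {mpoly K[n]}.
Proof.
move=> le; rewrite mpolyXU_exp -mpolyXD; congr 'X_[_]; apply/mnmP => l.
rewrite mnmDE mnmBE mulmnE mnm1E; case: eqVneq => [<-|]; last by rewrite subn0 addn0.
by rewrite mul1n subnK.
Qed.

(** A monomial outside the box has some exponent at least [k i], hence is a multiple of a
    generator. *)
Lemma box_ideal_generated k f :
  box_ideal k f <-> ideal_generated (pure_powers k) f.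
Proof.
split=> [fk|]; last first.
  by apply: ideal_generated_sub (box_idealP k) _ _ => _ [i ->]; apply: box_ideal_power.
have GI := ideal_pred_generated (@pure_powers K n k).
rewrite [f]mpolyE; apply: ideal_pred_sum => // m mf _.
have: ~~ in_box k m by apply: contraL mf => /fk/eqP; rewrite mcoeff_eq0.
rewrite negb_forall => /existsP[i]; rewrite -leqNgt => le.
rewrite (mpolyX_divide le) scalerAl; case: GI => _ _; apply.
by apply: ideal_generated_mem; exists i.
Qed.

Lemma box_ideal_const k f : (forall i, 0 < k i)%N -> box_ideal k f -> f@_0%MM = 0.
Proof. by move=> k0; apply; apply/forallP => i; rewrite mnm0E. Qed.

End Box.

(** * Dehomogenization and homogenization *)

Section Dehomogenization.
Variables (K : fieldType) (n : nat).
Local Notation P := {mpoly K[n.+1]}.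
Local Notation A := {mpoly K[n]}.

Lemma dehomog_additive : zmod_morphism (@dehomog K n).
Proof. exact: raddfB. Qed.

Lemma dehomog_monoid : monoid_morphism (@dehomog K n).
Proof. by split=> [|f g]; [exact: comp_mpoly1|exact: rmorphM]. Qed.

Lemma dehomog_scalable : scalable (@dehomog K n).
Proof. by move=> c f; exact: linearZ. Qed.

HB.instance Definition _ :=
  GRing.isZmodMorphism.Build P A (@dehomog K n) dehomog_additive.
HB.instance Definition _ :=
  GRing.isMonoidMorphism.Build P A (@dehomog K n) dehomog_monoid.
HB.instance Definition _ :=
  GRing.isScalable.Build K P A *:%R (@dehomog K n) dehomog_scalable.

Lemma dehomog_X0 : dehomog ('X_ord0 : P) = 1.
Proof. by rewrite /dehomog comp_mpolyXU -tnth_nth tnth_mktuple unlift_none. Qed.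

Lemma dehomog_lift j : dehomog ('X_(fintype.lift ord0 j) : P) = 'X_j.
Proof. by rewrite /dehomog comp_mpolyXU -tnth_nth tnth_mktuple liftK. Qed.

Definition mtail (m : 'X_{1..n.+1}) : 'X_{1..n} :=
  [multinom m (fintype.lift ord0 i) | i < n].

(** The power of [X_0] raises the degree to [D]; the subtraction is truncated, so this requires
    [mdeg m <= D]. *)
Definition mhom D (m : 'X_{1..n}) : 'X_{1..n.+1} :=
  [multinom if unlift ord0 i is Some j then m j else (D - mdeg m)%N | i < n.+1].

Lemma mdeg_mtail m : mdeg m = (m ord0 + mdeg (mtail m))%N.
Proof.
rewrite !mdegE big_ord_recl; congr (_ + _)%N.
by apply: eq_bigr => i _; rewrite mnmE.
Qed.

Lemma mhomK D m : mtail (mhom D m) = m.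
Proof. by apply/mnmP => i; rewrite !mnmE liftK. Qed.

Lemma mtailK m : mhom (mdeg m) (mtail m) = m.
Proof.
apply/mnmP => i; rewrite mnmE; case: unliftP => [j|] ->; first by rewrite mnmE.
by rewrite mdeg_mtail addnK.
Qed.

Lemma mdeg_mhom D m : (mdeg m <= D)%N -> mdeg (mhom D m) = D.
Proof. by move=> le; rewrite mdeg_mtail mhomK mnmE unlift_none subnK. Qed.

Lemma dehomog_mpolyX m : dehomog ('X_[m] : P) = 'X_[mtail m].
Proof.
rewrite mpolyXE_id rmorph_prod big_ord_recl rmorphXn /= dehomog_X0 expr1n mul1r.
rewrite [RHS]mpolyXE_id; apply: eq_bigr => i _.
by rewrite rmorphXn /= dehomog_lift mnmE.
Qed.

(** Among monomials of one degree the exponent of [X_0] is determined by the others, so no two terms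
    of [f] merge. *)
Lemma mcoeff_dehomog D (f : P) m :
  f \is D.-homog -> (mdeg m <= D)%N -> (dehomog f)@_m = f@_(mhom D m).
Proof.
move=> /dhomogP fD le; rewrite {1}[f]mpolyE rmorph_sum raddf_sum /=.
rewrite [in RHS](mpolyE f) raddf_sum /= !big_seq; apply: eq_bigr => m' mf.
rewrite linearZ /= !mcoeffZ dehomog_mpolyX !mcoeffX; congr (_ * (nat_of_bool _)%:R).
apply/eqP/eqP => [<-|->]; last exact: mhomK.
by rewrite -(fD _ mf) mtailK.
Qed.

Lemma dehomog_homog_inj D (f g : P) :
  f \is D.-homog -> g \is D.-homog -> dehomog f = dehomog g -> f = g.
Proof.
move=> fD gD E; apply/eqP; rewrite -subr_eq0; apply/eqP/mpolyP => m.
have uD : f - g \is D.-homog by exact: rpredB.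
rewrite mcoeff0; have [mD|ne] := eqVneq (mdeg m) D; last first.
  exact: dhomog_nemf_coeff uD ne.
rewrite -[m]mtailK mD -(mcoeff_dehomog uD) ?raddfB /= ?E ?subrr ?mcoeff0 //.
by rewrite -mD mdeg_mtail leq_addl.
Qed.

Definition homogenize D (g : A) : P :=
  \sum_(m <- msupp g) g@_m *: 'X_[mhom D m].

Lemma homogenizeK D g : dehomog (homogenize D g) = g.
Proof.
rewrite [RHS]mpolyE rmorph_sum; apply: eq_bigr => m _.
by rewrite /= linearZ /= dehomog_mpolyX mhomK.
Qed.

Lemma homogenize_homog D g : (msize g <= D.+1)%N -> homogenize D g \is D.-homog.
Proof.
move=> le; rewrite /homogenize big_seq; apply: rpred_sum => m mg; apply: rpredZ.
rewrite dhomogX /= mdeg_mhom //.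
by have := leq_trans (msize_mdeg_lt mg) le; rewrite ltnS.
Qed.

(** Each component of [h] is multiplied by the power of [X_0] that brings it to degree [N]; these
    powers become 1. *)
Lemma homogeneous_lift (Q : idealr P) N h :
  homogeneous_ideal Q -> h \in Q -> (msize h <= N)%N ->
  exists F, [/\ F \in Q, F \is N.-homog & dehomog F = dehomog h].
Proof.
move=> Qh hQ le.
have X0h e : ('X_ord0 ^+ e : P) \is e.-homog.
  by rewrite -[X in X.-homog]mul1n; apply/dhomogMn/homogX.
exists (\sum_(e < N) 'X_ord0 ^+ (N - e) * pihomog mdeg e h); split.
- by apply: rpred_sum => e _; apply/idealMr/Qh.
- apply: rpred_sum => e _.
  have := dhomogM (X0h (N - e)%N) (pihomogP mdeg e h).
  by rewrite subnK // ltnW.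
- rewrite {2}[h](pihomog_partitionE le) !rmorph_sum; apply: eq_bigr => e _.
  by rewrite rmorphM rmorphXn /= dehomog_X0 expr1n mul1r.
Qed.

(** A lift of [h] to the degree of [X_0^(msize h) f] equals that form, as dehomogenization is
    injective in each degree. *)
Lemma homogeneous_dehomog_mem (Q : idealr P) d f h :
  homogeneous_ideal Q -> h \in Q -> f \is d.-homog -> dehomog f = dehomog h ->
  exists N, 'X_ord0 ^+ N * f \in Q.
Proof.
move=> Qh hQ fd E; exists (msize h).
have [F [FQ Fd EF]] := homogeneous_lift Qh hQ (leq_addr d (msize h)).
suff -> : 'X_ord0 ^+ (msize h) * f = F by [].
apply: dehomog_homog_inj (Fd) _.
  by apply: dhomogM => //; rewrite -[X in X.-homog]mul1n; apply/dhomogMn/homogX.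
by rewrite rmorphM rmorphXn /= dehomog_X0 expr1n mul1r E.
Qed.

Lemma mderiv_dehomog i (f : P) :
  (dehomog f)^`M(i) = dehomog f^`M(fintype.lift ord0 i).
Proof.
rewrite mderiv_lrmorph big_ord_recl /= dehomog_X0 mderiv1 mulr0 add0r.
rewrite (bigD1 i) //= dehomog_lift mderivXU eqxx mulr1 big1 ?addr0 // => l ne.
by rewrite dehomog_lift mderivXU (negPf ne) mulr0.
Qed.

End Dehomogenization.

(** * Prime ideals avoiding the powers of an element *)

Section PrimeAvoiding.
Import classical_sets.
Variables (R : comNzRingType) (U : R -> Prop) (x : R).

Lemma prime_ideal_avoiding :
  ideal_pred U -> (forall e, ~ U (x ^+ e)) ->
  exists V : R -> Prop, [/\ ideal_pred V, forall u, U u -> V u,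
    forall e, ~ V (x ^+ e) & forall u v, V (u * v) -> V u \/ V v].
Proof.
move=> UI Ux.
pose good V := [/\ ideal_pred V, forall u, U u -> V u & forall e, ~ V (x ^+ e)].
pose Pz : set (set R) := fun V => V = set0 \/ good V.
have [F FP Ftot|V [[V0|[VI UV Vx]] Vmax]] := @Zorn_bigcup R Pz.
- have [[V0 [FV0 V0n]]|none] := pselect (exists V, F V /\ V <> set0); last first.
    left; apply/seteqP; split=> // u [V FV Vu]; case: none.
    by exists V; split=> // V0; rewrite V0 in Vu.
  right; have gF V u : F V -> V u -> good V.
    by move=> /FP[->//|].
  have [//|[[V00 _ _] UV0 _]] := FP _ FV0.
  split.
  + split; first by exists V0.
      move=> u v [V FV Vu] [W FW Wv].
      have [VI _ _] := gF _ _ FV Vu; have [WI _ _] := gF _ _ FW Wv.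
      have [sub|sub] := Ftot _ _ FV FW.
        by exists W => //; case: WI => _ WD _; apply: WD => //; apply: sub.
      by exists V => //; case: VI => _ VD _; apply: VD => //; apply: sub.
    move=> a u [V FV Vu]; exists V => //.
    by have [[_ _ VM] _ _] := gF _ _ FV Vu; apply: VM.
  + by move=> u Uu; exists V0 => //; apply: UV0.
  + by move=> e [V FV Vx]; have [_ _ /(_ e)] := gF _ _ FV Vx.
- case: (Vmax U); last by right; split.
  split; first by rewrite V0.
  by rewrite V0 => sub; case: UI => /sub.
- exists V; split=> // u v Vuv.
  (* By maximality, adjoining [w] to [V] produces a power of [x]. *)
  have ext w : ~ V w -> exists e a b, V b /\ x ^+ e = b + a * w.
    move=> Vw; apply: contrapT => none.
    pose W z := exists a b, V b /\ z = b + a * w.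
    case: VI => V0 VD VM.
    apply: (Vmax W).
      split=> [z Vz|sub]; first by exists 0, z; rewrite mul0r addr0; split.
      by apply: Vw; apply: sub; exists 1, 0; rewrite mul1r add0r; split.
    right; split.
    + split; first by exists 0, 0; rewrite mul0r addr0; split.
        move=> _ _ [a [b [Vb ->]]] [a' [b' [Vb' ->]]]; exists (a + a'), (b + b').
        by split; [exact: VD|ring].
      move=> c _ [a [b [Vb ->]]]; exists (c * a), (c * b).
      by split; [exact: VM|ring].
    + by move=> z /UV Vz; exists 0, z; rewrite mul0r addr0.
    + by move=> e [a [b [Vb E]]]; apply: none; exists e, a, b.
  (* If neither factor lay in [V], the product of the two powers of [x] so obtained would lie in
     [V]. *)
  apply: contrapT => /not_orP[/ext[e [a [b [Vb E]]]] /ext[e' [a' [b' [Vb' E']]]]].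
  apply: (Vx (e + e')%N); rewrite exprD E E'.
  rewrite (_ : _ * _ = (b' + a' * v) * b + (a * u * b' + a * a' * (u * v))); last by ring.
  by case: VI => _ VD VM; apply: (VD); [|apply: VD]; exact: VM.
Qed.

End PrimeAvoiding.

(** * Homogeneous prime ideals *)

Section HomogeneousCore.
Variables (K : fieldType) (n : nat).
Local Notation P := {mpoly K[n]}.

Lemma pihomogM_gt d e (u v : P) : u \is e.-homog -> (d < e)%N ->
  pihomog mdeg d (u * v) = 0.
Proof.
move=> ue lt; rewrite [v](pihomog_partitionE (leqnn (msize v))).
rewrite mulr_sumr raddf_sum big1 // => i _.
apply: (@pihomog_ne0 _ _ _ (e + i)); last exact: dhomogM ue (pihomogP _ _ _).
by rewrite neq_ltn (leq_trans lt (leq_addr _ _)) orbT.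
Qed.

Lemma pihomog_mul D (u v : P) :
  pihomog mdeg D (u * v) =
  \sum_(i < D.+1) pihomog mdeg i u * pihomog mdeg (D - i) v.
Proof.
have le := leq_addr D.+1 (msize u).
rewrite {1}[u](pihomog_partitionE le) mulr_suml raddf_sum.
rewrite (big_ord_widen_cond _ predT
  (fun i => pihomog mdeg i u * pihomog mdeg (D - i) v) (leq_addl (msize u) _)).
rewrite [RHS]big_mkcond; apply: eq_bigr => i _ /=; rewrite ltnS.
case: leqP => [leD|ltD]; last exact: pihomogM_gt (pihomogP _ _ _) ltD.
by rewrite -{1}(subnKC leD) pihomogM //; apply: pihomogP.
Qed.

(** [W] is the largest homogeneous ideal inside [V]. For primality, take the lowest components of
    [u] and [v] outside [V]: in the component of [u * v] in the sum of their degrees, every other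
    term has a factor in [V]. *)
Lemma homogeneous_core (V : P -> Prop) :
  ideal_pred V -> (forall u v, V (u * v) -> V u \/ V v) ->
  let W f := forall d, V (pihomog mdeg d f) in
  ideal_pred W /\ forall u v, W (u * v) -> W u \/ W v.
Proof.
move=> VI Vprime W; have [V0 VD VM] := VI; split.
  split=> [d|u v Wu Wv d|a u Wu d]; first by rewrite raddf0.
    by rewrite raddfD; apply: VD; [exact: Wu|exact: Wv].
  rewrite pihomog_mul; apply: ideal_pred_sum => // i _ _.
  by apply: VM; apply: Wu.
move=> u v Wuv; apply: contrapT => /not_orP[/existsNP/asboolP nu /existsNP/asboolP nv].
have low w : `[< exists d, ~ V (pihomog mdeg d w) >] ->
    exists d, ~ V (pihomog mdeg d w) /\
              forall i, (i < d)%N -> V (pihomog mdeg i w).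
  move=> /asboolP ex.
  have exb : exists d, `[< ~ V (pihomog mdeg d w) >].
    by case: ex => d Vd; exists d; apply/asboolP.
  have [d /asboolP Vd dmin] := ex_minnP exb.
  exists d; split=> // i lt; apply: contrapT => Vi.
  by have /dmin := asboolT Vi; rewrite leqNgt lt.
have [d [Vd dmin]] := low _ nu; have [e [Ve emin]] := low _ nv.
suff /Vprime[] : V (pihomog mdeg d u * pihomog mdeg e v) by [].
have lt : (d < (d + e).+1)%N by rewrite ltnS leq_addr.
have := Wuv (d + e)%N; rewrite pihomog_mul (bigD1 (Ordinal lt)) //= addKn.
set S := \sum_(i < _ | _) _ => VS.
rewrite -[X in V X](addrK S); apply: ideal_predB => //.
apply: ideal_pred_sum => // i _; rewrite -val_eqE /= neq_ltn => /orP[li|gi].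
  by apply: ideal_predMr => //; apply: dmin.
by apply: VM; apply: emin; rewrite ltn_subLR ?ltn_add2r // -ltnS.
Qed.

End HomogeneousCore.

Lemma homogeneous_prime_avoiding (K : fieldType) n (U : {mpoly K[n.+1]} -> Prop)
    (i : 'I_n.+1) :
  ideal_pred U -> (forall d f, U f -> U (pihomog mdeg d f)) ->
  (forall e, ~ U ('X_i ^+ e)) ->
  exists q : prime_idealr {mpoly K[n.+1]},
    [/\ homogeneous_ideal q, forall f, U f -> f \in q & 'X_i \notin q].
Proof.
move=> UI Uh Ux; have [V [VI UV Vx Vp]] := prime_ideal_avoiding UI Ux.
have [WI Wp] := homogeneous_core VI Vp.
set W := (fun f => forall d, V _) in WI Wp.
have WX : ~ W 'X_i.
  by move/(_ 1%N); rewrite pihomog_dE ?homogX // -['X_i]expr1 => /Vx.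
pose S : {pred {mpoly K[n.+1]}} := fun f => `[< W f >].
have SW f : reflect (W f) (f \in S) by exact: asboolP.
have [W0 WD WM] := WI.
have SI : idealr_closed S.
  split; first exact/SW.
    by apply/SW => W1; apply: WX; rewrite -['X_i]mulr1; apply: WM.
  by move=> a u v /SW Wu /SW Wv; apply/SW/WD => //; apply: WM.
have Sp : prime_idealr_closed S.
  by move=> u v /SW/Wp[] /SW ->; rewrite ?orbT.
pose q : prime_idealr {mpoly K[n.+1]} :=
  HB.pack (S : {mpoly K[n.+1]} -> bool) (isIdealr.Build _ _ SI)
          (isPrimeIdealrClosed.Build _ _ Sp).
exists q; split; last by apply/SW.
- move=> d f /SW Wf; apply/SW => e; have := Wf e.
  have [<-|ne] := eqVneq d e; first by rewrite pihomog_id.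
  by case: VI => V0 _ _; rewrite (pihomog_ne0 ne (pihomogP _ _ _)).
- by move=> f Uf; apply/SW => d; apply/UV/Uh.
Qed.

(** * The hyperplane at infinity *)

Section HyperplaneSection.
Variables (K : fieldType) (n : nat) (I : idealr {mpoly K[n.+1]}).
Local Notation P := {mpoly K[n.+1]}.
Hypothesis Ih : homogeneous_ideal I.

Definition adjoin_X0 (f : P) : Prop := exists h : P, f - 'X_ord0 * h \in I.

Lemma adjoin_X0_ideal : ideal_pred adjoin_X0.
Proof.
split=> [|u v [a ua] [b vb]|a u [b ub]].
- by exists 0; rewrite mulr0 subr0 idealr0.
- by exists (a + b); rewrite mulrDr opprD addrACA rpredD.
- by exists (a * b); rewrite mulrCA -mulrBr idealMr.
Qed.

Lemma adjoin_X0_homog d (f : P) : f \is d.+1.-homog -> adjoin_X0 f ->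
  exists2 g, g \is d.-homog & f - 'X_ord0 * g \in I.
Proof.
move=> fd [h /(@Ih d.+1)]; rewrite raddfB /= pihomog_dE //.
by rewrite -[d.+1]add1n pihomogM ?homogX // => ?; exists (pihomog mdeg d h) => //; apply: pihomogP.
Qed.

Lemma adjoin_X0_pihomog d f : adjoin_X0 f -> adjoin_X0 (pihomog mdeg d f).
Proof.
move=> [h /(@Ih d)]; rewrite raddfB /=; case: d => [|d].
  rewrite (pihomogM_gt _ (homogX _ _)) // => ?.
  by exists 0; rewrite mulr0.
by rewrite -[d.+1]add1n pihomogM ?homogX // => ?; exists (pihomog mdeg d h).
Qed.

(** Otherwise some homogeneous prime would contain [I] and [X_0] but not [X_i]; it is a closed point
    by zero-dimensionality, and it lies on the hyperplane. *)
Lemma closed_points_avoid_hyperplane (s : nat) (pt : 'I_s -> prime_idealr P) :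
  zero_dimensional I -> enumerates_support I pt ->
  (forall j, 'X_ord0 \notin pt j) ->
  forall i, exists e, adjoin_X0 ('X_i ^+ e).
Proof.
move=> [_ closed] [_ _ enum] X0 i; apply: contrapT => none.
have [//|q [qh Uq qi]] :=
  homogeneous_prime_avoiding adjoin_X0_ideal adjoin_X0_pihomog (i := i).
  by move=> e Ue; apply: none; exists e.
have /closed/enum[j qj] : scheme_point I q.
  split=> // [f fI|]; last by exists i.
  by apply: Uq; exists 0; rewrite mulr0 subr0.
move: (X0 j); rewrite -qj Uq //; exists 1.
by rewrite mulr1 subrr idealr0.
Qed.

(** By the pigeonhole principle a monomial of degree above the sum of the [e i] is divisible by some
    [X_i^(e i)], so [I + <X_0>] contains all forms of large degree. *)
Lemma hyperplane_multiplication_onto :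
  (forall i, exists e, adjoin_X0 ('X_i ^+ e)) ->
  exists N, forall d f, (N <= d)%N -> f \is d.+1.-homog ->
    exists2 g : P, g \is d.-homog & f - 'X_ord0 * g \in I.
Proof.
move=> /choice[e eP].
exists (\sum_i e i)%N => d f le fd; apply: adjoin_X0_homog => //.
rewrite [f]mpolyE; apply: (ideal_pred_sum adjoin_X0_ideal) => m mf _.
have [_ _ UM] := adjoin_X0_ideal.
rewrite -mul_mpolyC; apply: (UM).
have [i lei] : exists i, (e i <= m i)%N.
  apply: contrapT => /forallNP lt.
  have := fd; move/dhomogP/(_ _ mf); rewrite /= mdegE => md.
  have: (\sum_i m i <= \sum_i e i)%N.
    by apply: leq_sum => i _; rewrite ltnW // ltnNge; apply/negP/lt.
  by rewrite md leqNgt ltnS le.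
by rewrite (mpolyX_divide K lei); apply: UM.
Qed.

End HyperplaneSection.

(** * Torsion in graded modules *)

Section Stabilisation.
Variables (K : fieldType) (R : comNzRingType) (f : {rmorphism K -> R}).
Variables (M : lmodType R) (gr : nat -> M -> Prop) (t : R).

Definition spanned_by d h : Prop := exists b : 'I_h -> M,
  (forall i, gr d (b i)) /\
  forall w, gr d w -> exists c : 'I_h -> K, w = \sum_i f (c i) *: b i.

Lemma eventually_torsion_free N h0 :
  (forall d w, (N <= d)%N -> gr d w -> gr d.+1 (t *: w)) ->
  (forall d w, (N <= d)%N -> gr d.+1 w -> exists2 v, gr d v & w = t *: v) ->
  spanned_by N h0 ->
  exists d1, forall d L w, (d1 <= d)%N -> gr d w -> t ^+ L *: w = 0 -> w = 0.
Proof.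
move=> grt tgr sp0.
pose Q h := `[< exists2 d, (N <= d)%N & spanned_by d h >].
have exQ : exists h, Q h by exists h0; apply/asboolP; exists N.
have [h /asboolP[d1 Nd1 sp1] hmin] := ex_minnP exQ.
have grtL d w L : (N <= d)%N -> gr d w -> gr (d + L)%N (t ^+ L *: w).
  move=> Nd gw; elim: L => [|L IH]; first by rewrite addn0 expr0 scale1r.
  by rewrite addnS exprS -scalerA; apply: grt => //; apply: leq_trans (leq_addr _ _).
have tgrL d w L : (N <= d)%N -> gr (d + L)%N w ->
    exists2 v, gr d v & w = t ^+ L *: v.
  move=> Nd; elim: L w => [|L IH] w.
    by rewrite addn0 => gw; exists w => //; rewrite expr0 scale1r.
  rewrite addnS => /tgr[|v gv ->]; first exact: leq_trans (leq_addr _ _).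
  have [u gu ->] := IH _ gv; exists u => //.
  by rewrite scalerA -exprS.
have shift d L h' b : (N <= d)%N -> (forall i : 'I_h', gr d (b i)) ->
    (forall w, gr d w -> exists c : 'I_h' -> K, w = \sum_i f (c i) *: b i) ->
    forall w, gr (d + L)%N w -> exists c : 'I_h' -> K,
      w = \sum_i f (c i) *: (t ^+ L *: b i).
  move=> Nd gb sb w /(tgrL _ _ _ Nd)[v /sb[c ->] ->]; exists c.
  rewrite scaler_sumr; apply: eq_bigr => i _.
  by rewrite !scalerA mulrC.
exists d1 => d L w led gw tw0.
have Nd : (N <= d)%N := leq_trans Nd1 led.
have [b [gb sb]] : spanned_by d h.
  have [b0 [gb0 sb0]] := sp1; exists (fun i => t ^+ (d - d1) *: b0 i); split.
    by move=> i; rewrite -{1}(subnKC led); apply: grtL.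
  by have := shift _ (d - d1)%N _ _ Nd1 gb0 sb0; rewrite subnKC.
have [c wE] := sb _ gw.
suff c0 i : c i = 0 by rewrite wE big1 // => i _; rewrite c0 rmorph0 scale0r.
apply/eqP; apply: contraT => ci0; exfalso.
case: h hmin {sp1} b gb sb c wE i ci0 => [|h] hmin b gb sb c wE i ci0.
  by case: i {ci0}.
suff: Q h by move/hmin; rewrite ltnn.
apply/asboolP; exists (d + L)%N; first exact: leq_trans (leq_addr _ _).
exists (fun l => t ^+ L *: b (fintype.lift i l)); split=> [l|v gv].
  exact: grtL.
have [a ->] := shift _ L _ b Nd gb sb _ gv.
(* The relation [t ^+ L *: w = 0], solved for the generator whose coefficient in [w] is nonzero. *)
have bi : t ^+ L *: b i =
    \sum_l f (- (c i)^-1 * c (fintype.lift i l)) *: (t ^+ L *: b (fintype.lift i l)).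
  have E : f (c i) *: (t ^+ L *: b i) =
      - \sum_l f (c (fintype.lift i l)) *: (t ^+ L *: b (fintype.lift i l)).
    apply/eqP; rewrite -subr_eq0 opprK -(bigD1_ord i (P := predT)
      (F := fun l => f (c l) *: (t ^+ L *: b l))) //.
    rewrite -[X in _ == X]tw0 wE scaler_sumr; apply/eqP/eq_bigr => l _.
    by rewrite !scalerA mulrC.
  rewrite -[LHS]scale1r -(rmorph1 f) -(mulVf ci0) rmorphM -scalerA E.
  rewrite scalerN scaler_sumr -sumrN; apply: eq_bigr => l _.
  by rewrite mulNr rmorphN rmorphM scaleNr -[in RHS]scalerA.
exists (fun l => a (fintype.lift i l) + a i * (- (c i)^-1 * c (fintype.lift i l))).
rewrite (bigD1_ord i) //= bi scaler_sumr addrC -big_split; apply: eq_bigr => l _.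
by rewrite /= rmorphD [f (_ * _)]rmorphM scalerDl -[in RHS]scalerA.
Qed.

End Stabilisation.

(** * Differential forms on the coordinate ring *)

Section KaehlerDifferentials.
Variables (K : fieldType) (n : nat) (I : idealr {mpoly K[n.+1]}).
Local Notation P := {mpoly K[n.+1]}.
Local Notation proj := (coord_proj I).
Local Notation d := (kaehler_d (coord_const I)).

Lemma coord_proj_eqP (f g : P) : reflect (proj f = proj g) (f - g \in I).
Proof. by rewrite Quotient.idealrBE; apply: eqP. Qed.

Lemma coord_proj_eq0P (f : P) : reflect (proj f = 0) (f \in I).
Proof. by have := coord_proj_eqP f 0; rewrite subr0 rmorph0. Qed.

Lemma coord_proj_surj (x : coord_ring I) : exists f, x = proj f.
Proof. by exists (repr (x : {ideal_quot I})); rewrite /= reprK. Qed.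

Definition omega (r : 'I_n.+1 -> P) : Omega1 I := \sum_l proj (r l) *: d (proj 'X_l).

Lemma Omega1_component_omega e r : (forall l, r l \is e.-homog) ->
  Omega1_component e.+1 (omega r).
Proof. by exists r. Qed.

Lemma omegaD r r' : omega (fun l => r l + r' l) = omega r + omega r'.
Proof. by rewrite -big_split; apply: eq_bigr => l _; rewrite rmorphD scalerDl. Qed.

Lemma omegaM a r : omega (fun l => a * r l) = proj a *: omega r.
Proof. by rewrite scaler_sumr; apply: eq_bigr => l _; rewrite rmorphM scalerA. Qed.

Lemma omega0 : omega (fun=> 0) = 0.
Proof. by rewrite /omega big1 // => l _; rewrite rmorph0 scale0r. Qed.

Lemma omega_sum (T : finType) (r : T -> 'I_n.+1 -> P) :
  omega (fun l => \sum_t r t l) = \sum_t omega (r t).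
Proof.
rewrite /omega [RHS]exchange_big; apply: eq_bigr => l _.
by rewrite rmorph_sum scaler_suml.
Qed.

Lemma eq_omega r r' : (forall l, r l - r' l \in I) -> omega r = omega r'.
Proof. by move=> E; apply: eq_bigr => l _; congr (_ *: _); apply/coord_proj_eqP. Qed.

Lemma kaehler_d_proj f : d (proj f) = omega (fun l => f^`M(l)).
Proof.
have [dD dM dC] := kaehler_d_derivation (coord_const I).
elim/mpoly_alg_ind: f => [c|i|u v Hu Hv|u v Hu Hv].
- rewrite [LHS](dC c) -omega0; apply: eq_omega => l.
  by rewrite mderivC subr0 idealr0.
- rewrite /omega (bigD1 i) //= mderivXU eqxx !rmorph1 scale1r big1 ?addr0 //.
  by move=> l ne; rewrite mderivXU eq_sym (negPf ne) !rmorph0 scale0r.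
- rewrite rmorphD dD Hu Hv -omegaD; apply: eq_omega => l.
  by rewrite mderivD subrr idealr0.
- rewrite rmorphM dM Hu Hv -!omegaM -omegaD; apply: eq_omega => l.
  by rewrite /= mderivM [X in X - _]addrC [_ * v]mulrC subrr idealr0.
Qed.

Lemma omega_grad_eq0 f : f \in I -> omega (fun l => f^`M(l)) = 0.
Proof.
move=> fI; rewrite -kaehler_d_proj.
have [_ _ dC] := kaehler_d_derivation (coord_const I).
rewrite -(dC 0); congr (kaehler_d _ _); rewrite rmorph0.
exact/coord_proj_eq0P.
Qed.

(* The vector field [\sum_l c l * d/dX_l] induces a derivation from R to P/U,
   through which every relation between the dX_l is tested. *)
Lemma omega_eq0_test (U : P -> Prop) (c r : 'I_n.+1 -> P) :
  ideal_pred U -> (forall f, f \in I -> U f) ->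
  (forall f, f \in I -> U (\sum_l c l * f^`M(l))) ->
  omega r = 0 -> U (\sum_l c l * r l).
Proof.
move=> UI IU cU; pose R := coord_ring I.
pose S : R^o -> Prop := fun x => exists2 u, U u & x = proj u.
(* [M] is [P/U], built as a quotient of [R] so that it is an [R]-module from the start. *)
pose M : lmodType R := quotmod S.
pose q (f : P) : M := quotmod_proj S (proj f : R^o).
have [U0 UD UM] := UI.
have spanS (x : R^o) : x \in submod_span S -> exists2 u, U u & x = proj u.
  move=> /asboolP[s Ss ->]; elim: s Ss => [|[a x'] s IH] Ss.
    by exists 0; rewrite ?big_nil ?rmorph0.
  have [|u Uu uE] := IH; first by move=> y ys; apply: Ss; rewrite inE ys orbT.
  have [|v Uv /= ->] := Ss (a, x'); first by rewrite inE eqxx.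
  have [b ->] := coord_proj_surj a.
  exists (b * v + u); first by apply: UD => //; apply: UM.
  by rewrite big_cons uE rmorphD rmorphM.
have qP f g : q f = q g <-> U (f - g).
  split=> [/quotmod_eqP/spanS[u Uu E]|Ufg].
    have /IU IUu : (f - g) - u \in I by apply/coord_proj_eqP; rewrite -E rmorphB.
    by rewrite -(subrK u (f - g)); apply: UD.
  by apply/quotmod_eqP/mem_submod_span; exists (f - g) => //; rewrite rmorphB.
have qD f g : q (f + g) = q f + q g by rewrite /q !rmorphD raddfD.
have qM f g : q (f * g) = proj f *: q g.
  by rewrite /q rmorphM; apply: (esym (quotmod_scaleE S (proj f) (proj g : R^o))).
pose X f := \sum_l c l * f^`M(l).
pose D (x : R) : M := q (X (repr (x : {ideal_quot I}))).
have XD f g : X (f + g) = X f + X g.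
  by rewrite /X -big_split; apply: eq_bigr => l _; rewrite mderivD mulrDr.
have XN f : X (- f) = - X f.
  by rewrite /X -sumrN; apply: eq_bigr => l _; rewrite mderivN mulrN.
have XM f g : X (f * g) = f * X g + g * X f.
  rewrite /X !mulr_sumr -big_split; apply: eq_bigr => l _ /=.
  by rewrite mderivM; ring.
(* The choice of representative does not matter, because [X] maps [I] into [U]. *)
have DE f : D (proj f) = q (X f).
  apply/qP; rewrite -XN -XD; apply/cU/coord_proj_eqP.
  exact: (@reprK _ {ideal_quot I}).
have Dder : is_derivation (coord_const I) D.
  split=> [a b|a b|e].
  - have [f ->] := coord_proj_surj a; have [g ->] := coord_proj_surj b.
    by rewrite -rmorphD !DE XD qD.
  - have [f ->] := coord_proj_surj a; have [g ->] := coord_proj_surj b.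
    by rewrite -rmorphM !DE XM qD !qM.
  - rewrite [D _]DE /X big1 => [|l _]; last by rewrite mderivC mulr0.
    by rewrite /q rmorph0 raddf0.
have [phi [phiD _]] := kaehler_universal Dder.
move=> w0; suff: q (\sum_l c l * r l) = q 0 by move/qP; rewrite subr0.
have q0 : q 0 = 0 by rewrite /q rmorph0 raddf0.
rewrite q0 -(raddf0 phi) -w0 raddf_sum (big_morph q qD q0); apply: eq_bigr => l _.
rewrite /= linearZ /= phiD DE mulrC qM; congr (_ *: q _).
rewrite /X (bigD1 l) //= mderivXU eqxx mulr1 big1 ?addr0 // => l' ne.
by rewrite mderivXU eq_sym (negPf ne) mulr0.
Qed.

Lemma homog_finite_generators e : exists s : seq P,
  (forall b, b \in s -> b \is e.-homog) /\
  forall f : P, f \is e.-homog -> f = \sum_(b <- s) f@_(mlead b) *: b.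
Proof.
pose s := [seq m <- [seq val m | m <- enum {: 'X_{1..n.+1 < e.+1}}] | mdeg m == e].
exists [seq 'X_[m] | m <- s : seq 'X_{1..n.+1}]; split.
  by move=> b /mapP[m mE ->]; rewrite dhomogX; move: mE; rewrite mem_filter => /andP[].
move=> f fe; rewrite big_map; apply/mpolyP => m; rewrite raddf_sum /=.
under eq_bigr => m' _ do rewrite mleadXm mcoeffZ mcoeffX.
have us : uniq s.
  by rewrite filter_uniq // map_inj_uniq ?enum_uniq //; apply: val_inj.
have [ms|ms] := boolP (m \in s).
  rewrite (bigD1_seq m) //= eqxx mulr1 big1 ?addr0 // => m' /negPf ne.
  by rewrite ne mulr0.
rewrite big1_seq => [|m' /andP[_ m's]].
  apply: dhomog_nemf_coeff fe _; apply: contra ms => /eqP /= me.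
  have lt : (mdeg m < e.+1)%N by rewrite me.
  rewrite mem_filter me eqxx; apply/mapP.
  by exists (BMultinom lt) => //; rewrite mem_enum.
by case: eqVneq => [E|_]; [rewrite -E m's in ms|rewrite mulr0].
Qed.

End KaehlerDifferentials.

Lemma spanned_by_fin (K : fieldType) (R : comNzRingType) (f : {rmorphism K -> R})
    (M : lmodType R) (gr : nat -> M -> Prop) d (T : finType) (b : T -> M) :
  (forall t, gr d (b t)) ->
  (forall w, gr d w -> exists c : T -> K, w = \sum_t f (c t) *: b t) ->
  spanned_by f gr d #|T|.
Proof.
move=> gb sb; exists (fun x => b (enum_val x)); split=> // w /sb[c ->].
exists (fun x => c (enum_val x)).
by rewrite (reindex (@enum_val T T)) //; apply/onW_bij/enum_val_bij.
Qed.

(** Surjectivity of [X_0] on coefficients passes to forms. As [dX_l] has degree 1, the starting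
    degree is [N + 1], with generators [b dX_l], where [b] runs through generators of degree [N]. *)
Lemma omega_torsion_free (K : fieldType) n (I : idealr {mpoly K[n.+1]}) N :
  (forall d f, (N <= d)%N -> f \is d.+1.-homog ->
    exists2 g : {mpoly K[n.+1]}, g \is d.-homog & f - 'X_ord0 * g \in I) ->
  exists d1, forall d L w, (d1 <= d)%N -> Omega1_component (I := I) d w ->
    coord_proj I 'X_ord0 ^+ L *: w = 0 -> w = 0.
Proof.
move=> onto; have [gens [gens_homog gensE]] := homog_finite_generators K n N.
pose gen (x : 'I_n.+1 * 'I_(size gens)) : Omega1 I :=
  coord_proj I gens`_x.2 *: kaehler_d (coord_const I) (coord_proj I 'X_x.1).
have genE x : gen x = omega I (fun l => (l == x.1)%:R * gens`_x.2).
  rewrite /omega (bigD1 x.1) //= eqxx mul1r big1 ?addr0 // => l /negPf ->.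
  by rewrite mul0r rmorph0 scale0r.
apply: (@eventually_torsion_free K _ (coord_const I) _
          (@Omega1_component K n I) _ N.+1 #|{: 'I_n.+1 * 'I_(size gens)}|).
- move=> [//|d] w _ [r rd ->]; exists (fun l => 'X_ord0 * r l).
    by move=> l; rewrite -[d.+1]add1n; apply/dhomogM/rd/homogX.
  exact: (esym (omegaM I 'X_ord0 r)).
- move=> [//|d] w le [r rd ->].
  have /choice[g gP] l : exists g : {mpoly K[n.+1]},
      g \is d.-homog /\ r l - 'X_ord0 * g \in I.
    by have [g gd gI] := onto d _ le (rd l); exists g.
  exists (omega I g); first by exists g => // l; case: (gP l).
  by rewrite -omegaM; apply: eq_omega => l; case: (gP l).
- apply: (spanned_by_fin (b := gen)) => [x|w [r rd ->]].
    rewrite genE; exists (fun l => (l == x.1)%:R * gens`_x.2) => // l.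
    have gx : gens`_x.2 \is N.-homog by apply/gens_homog/mem_nth.
    by case: (l == x.1); rewrite ?mul1r ?mul0r // dhomog0.
  exists (fun x : 'I_n.+1 * 'I_(size gens) => (r x.1)@_(mlead gens`_x.2)).
  rewrite -(pair_bigA _ (fun (l : 'I_n.+1) (i : 'I_(size gens)) =>
    coord_const I (r l)@_(mlead gens`_i) *:
    (coord_proj I gens`_i *: kaehler_d (coord_const I) (coord_proj I 'X_l)))) /=.
  apply: eq_bigr => l _; rewrite {1}(gensE _ (rd l)) rmorph_sum scaler_suml.
  rewrite (big_nth 0) big_mkord; apply: eq_bigr => i _.
  by rewrite scalerA -mul_mpolyC rmorphM.
Qed.

(** * Linear changes of coordinates *)

Section LinearChange.
Variables (K : fieldType) (n : nat).
Local Notation A := {mpoly K[n]}.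

Lemma lrmorphism_inverse (phi : {lrmorphism A -> A}) : bijective phi ->
  exists psi : {lrmorphism A -> A}, cancel phi psi /\ cancel psi phi.
Proof.
case=> psi phiK psiK.
pose q : {lrmorphism A -> A} := HB.pack psi
  (GRing.isZmodMorphism.Build _ _ psi (can2_zmod_morphism phiK psiK))
  (GRing.isMonoidMorphism.Build _ _ psi (can2_monoid_morphism phiK psiK))
  (GRing.isScalable.Build _ _ _ _ psi (can2_scalable phiK psiK)).
by exists q.
Qed.

Lemma mderiv_msize2 i (g : A) : msize g = 2%N -> g^`M(i) = (g^`M(i)@_0)%:MP.
Proof.
move=> g2; apply: msize1_polyC; rewrite msizeE big_seq.
elim/big_ind: _ => [//|x y x1 y1|m]; first by rewrite geq_max x1.
rewrite mcoeff_msupp mcoeff_mderiv => nz.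
have: (m + U_(i))%MM \in msupp g.
  by rewrite mcoeff_msupp; apply: contraNneq nz => ->; rewrite mul0rn.
by move/msize_mdeg_lt; rewrite g2 mdegD mdeg1 addn1.
Qed.

(** [a] is the Jacobian matrix of [phi], constant because each [phi X_l] has degree 1. The chain
    rule applied to [psi X_i], with [phi (psi X_i) = X_i], yields its inverse [b]; a one-sided
    inverse of a square matrix is two-sided. *)
Lemma linear_change_jacobian (phi : {lrmorphism A -> A}) : linear_change phi ->
  exists a b : 'I_n -> 'I_n -> K,
    [/\ forall g i, (phi g)^`M(i) = \sum_l (a l i)%:MP * phi g^`M(l),
        forall l l', \sum_i a l i * b i l' = (l == l')%:R &
        forall i i', \sum_l b i l * a l i' = (i == i')%:R].
Proof.
case=> /lrmorphism_inverse[psi [phiK psiK]] phi2.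
pose a l i := (phi 'X_l)^`M(i)@_0; pose b i l := (phi (psi 'X_i)^`M(l))@_0.
have gradE g i : (phi g)^`M(i) = \sum_l (a l i)%:MP * phi g^`M(l).
  rewrite mderiv_lrmorph; apply: eq_bigr => l _.
  by rewrite mulrC mderiv_msize2.
have ba i i' : \sum_l b i l * a l i' = (i == i')%:R.
  have := congr1 (mcoeff 0) (gradE (psi 'X_i) i').
  rewrite psiK mderivXU -mpolyC_nat mcoeffC eqxx mulr1 raddf_sum => ->.
  by apply: eq_bigr => l _; rewrite /= mcoeffCM mulrC.
exists a, b; split=> // l l'.
have BA : (\matrix_(i, l) b i l) *m (\matrix_(l, i) a l i) = 1%:M.
  apply/matrixP => i i'; rewrite !mxE -ba; apply: eq_bigr => x _.
  by rewrite !mxE.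
move/mulmx1C/matrixP/(_ l l'): BA; rewrite !mxE => <-.
by apply: eq_bigr => x _; rewrite !mxE.
Qed.

End LinearChange.

(** * Nilpotent elements modulo a box ideal *)

Section Nilpotence.
Variables (K : fieldType) (n : nat).

Lemma order_exp (f : {mpoly K[n]}) N : f@_0%MM = 0 ->
  forall m, (mdeg m < N)%N -> (f ^+ N)@_m = 0.
Proof.
move=> f0; elim: N => [//|N IH] m lt; rewrite exprS mcoeffM big1 // => q /eqP mE.
have [q0|q0] := eqVneq (q.1 : 'X_{1..n}) 0%MM; first by rewrite q0 f0 mul0r.
rewrite IH ?mulr0 //.
have mE' := congr1 (@mdeg n) mE; rewrite mdegD in mE'.
rewrite -ltnS (leq_trans _ lt) // ltnS [X in (_ <= X)%N]mE'.
by rewrite -add1n leq_add2r lt0n mdeg_eq0.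
Qed.

(** Powers of [f] have growing order at the origin, while monomials in the box have degree at most
    the sum of the [k i]. *)
Lemma box_ideal_nilpotent k (f : {mpoly K[n]}) : f@_0%MM = 0 ->
  exists N, box_ideal k (f ^+ N).
Proof.
move=> f0; exists (\sum_i k i).+1 => m /forallP mk; apply: order_exp => //.
by rewrite ltnS mdegE; apply: leq_sum => i _; apply/ltnW/mk.
Qed.

Lemma mcoeff0M (f g : {mpoly K[n]}) : (f * g)@_0%MM = f@_0%MM * g@_0%MM.
Proof. exact: (rmorphM (mcoeff 0%MM)). Qed.

Lemma mcoeff0X (f : {mpoly K[n]}) e : (f ^+ e)@_0%MM = f@_0%MM ^+ e.
Proof. exact: (rmorphXn (mcoeff 0%MM)). Qed.

End Nilpotence.

(** * Values at the points of the support *)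

Section LocallyMonomial.
Variables (K : fieldType) (p n : nat).
Local Notation P := {mpoly K[n.+1]}.
Local Notation A := {mpoly K[n]}.
Variables (I : idealr P) (s : nat) (pt : 'I_s -> prime_idealr P).
Variables (J : 'I_s -> idealr A) (phi psi : 'I_s -> {lrmorphism A -> A}).
Variables (k : 'I_n -> 'I_s -> nat) (a b : 'I_s -> 'I_n -> 'I_n -> K).
Hypothesis Ih : homogeneous_ideal I.
Hypothesis pt_homog : forall j, homogeneous_ideal (pt j).
Hypothesis pt_inj : forall j j', pt j =i pt j' -> j = j'.
Hypothesis X0_pt : forall j, 'X_ord0 \notin pt j.
Hypothesis radJ : forall j g, in_radical (J j) g <-> dehomog_ideal (pt j) g.
Hypothesis IJ : forall g, dehomog_ideal I g <-> forall j, g \in J j.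
Hypothesis k_gt0 : forall i j, (0 < k i j)%N.
Hypothesis memJ : forall j g, g \in J j <-> box_ideal (k^~ j) (phi j g).
Hypothesis psiK : forall j, cancel (psi j) (phi j).
Hypothesis grad_phi : forall j g i,
  (phi j g)^`M(i) = \sum_l (a j l i)%:MP * phi j g^`M(l).
Hypothesis ab : forall j l l', \sum_i a j l i * b j i l' = (l == l')%:R.
Hypothesis ba : forall j i i', \sum_l b j i l * a j l i' = (i == i')%:R.
Hypothesis charK : forall i j, (p %| k i j)%N = ((k i j)%:R == 0 :> K).

(** The value of [g] at the [j]-th point, which [phi j] moves to the origin. *)
Definition residue j (g : A) : K := (phi j g)@_0%MM.

Lemma residueB j f g : residue j (f - g) = residue j f - residue j g.
Proof. by rewrite /residue rmorphB raddfB. Qed.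

Lemma residueC j c : residue j c%:MP = c.
Proof. by rewrite /residue lrmorphC mcoeffC eqxx mulr1. Qed.

Lemma residueM j f g : residue j (f * g) = residue j f * residue j g.
Proof. by rewrite /residue rmorphM mcoeff0M. Qed.

Lemma in_radicalJ j g : in_radical (J j) g <-> residue j g = 0.
Proof.
split=> [[e /memJ]|g0]; last first.
  have [e ge] := box_ideal_nilpotent (k^~ j) g0.
  by exists e; apply/memJ; rewrite rmorphXn.
move/(box_ideal_const (fun i => k_gt0 i j)); rewrite rmorphXn mcoeff0X.
by move/eqP; rewrite expf_eq0 => /andP[_ /eqP].
Qed.

(** Dehomogenizing loses only a power of [X_0], which cancels modulo a prime not containing
    [X_0]. *)
Lemma mem_pt_homog j d (f : P) : f \is d.-homog ->
  f \in pt j <-> residue j (dehomog f) = 0.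
Proof.
move=> fd; rewrite -in_radicalJ radJ; split=> [fp|[h hp E]]; first by exists f.
have [N] := homogeneous_dehomog_mem (@pt_homog j) hp fd (esym E).
rewrite prime_idealrM => /orP[|//]; elim: N => [|N IH]; first by rewrite idealr1.
by rewrite exprS prime_idealrM (negPf (X0_pt j)).
Qed.

Lemma mem_pt j (f : P) :
  f \in pt j <-> forall d, residue j (dehomog (pihomog mdeg d f)) = 0.
Proof.
split=> [fp d|f0].
  by apply/(mem_pt_homog _ (pihomogP _ _ _)); apply: pt_homog.
rewrite [f](pihomog_partitionE (leqnn (msize f))); apply: rpred_sum => d _.
by apply/(mem_pt_homog _ (pihomogP _ _ _)).
Qed.

(** If vanishing at [j] implied vanishing at [j'], then subtracting from [y] the constant
    [residue j y] would show that the two values always agree, so that the two primes are equal. *)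
Lemma residue_separate j j' : j != j' ->
  exists2 y, residue j y = 0 & residue j' y = 1.
Proof.
move=> ne; have [[y [y0 y'0]]|none] :=
    pselect (exists y, residue j y = 0 /\ residue j' y <> 0).
  exists (y * (residue j' y)^-1%:MP); rewrite residueM residueC ?y0 ?mul0r //.
  by rewrite divff //; apply/eqP.
have sub y : residue j y = 0 -> residue j' y = 0.
  by move=> y0; apply: contrapT => y'; apply: none; exists y.
have residueE y : residue j' y = residue j y.
  have : residue j (y - (residue j y)%:MP) = 0 by rewrite residueB residueC subrr.
  by move/sub; rewrite residueB residueC => /subr0_eq.
case/eqP: ne; apply: pt_inj => f; apply/idP/idP => /mem_pt f0; apply/mem_pt => d.
  by rewrite residueE.
by rewrite -residueE.
Qed.

(** * Separating functions with vanishing derivatives *)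

(** With the derivatives included, any multiple of such an [f] has its gradient in [J j] too. *)
Definition vanishes_doubly j (f : A) : Prop :=
  f \in J j /\ forall l, f^`M(l) \in J j.

Lemma vanishes_doubly_ideal j : ideal_pred (vanishes_doubly j).
Proof.
split=> [|u v [uJ du] [vJ dv]|c u [uJ du]].
- by split=> [|l]; rewrite ?mderiv0 idealr0.
- by split=> [|l]; rewrite ?mderivD rpredD.
- split=> [|l]; first exact: idealMr.
  by rewrite mderivM rpredD ?idealMr // mulrC idealMr.
Qed.

(** The witness [1 - (1 - w) ^+ M] is a multiple of [w], a power of [1 - y]; and [1 - w] is a
    multiple of [y], whose [M]-th power lies in [J j]. *)
Lemma separating_pair j j' : j != j' ->
  exists e, 1 - e \in J j /\ vanishes_doubly j' e.
Proof.
move=> /residue_separate[y /in_radicalJ[M yM] y'1].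
have [N zN] : in_radical (J j') (1 - y).
  by apply/in_radicalJ; rewrite residueB -mpolyC1 residueC y'1 subrr.
have [_ _ VM] := vanishes_doubly_ideal j'.
(* One power more than membership in [J j'] requires, since differentiation costs one. *)
pose w := (1 - y) ^+ N.+1.
have wV : vanishes_doubly j' w.
  split=> [|l]; first by rewrite /w exprS idealMr.
  by rewrite mderivXn idealMr // mulrC idealMr.
have [q wE] : exists q, 1 - w = q * y.
  exists (\sum_(i < N.+1) (1 - y) ^+ i).
  by rewrite /w -[1 - _]opprB subrX1 mulrC; ring.
have [q' eE] : exists q', 1 - (1 - w) ^+ M = q' * w.
  exists (\sum_(i < M) (1 - w) ^+ i).
  by rewrite -[1 - _ ^+ _]opprB subrX1 mulrC; ring.
exists (1 - (1 - w) ^+ M); split; last by rewrite eE; apply: VM.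
by rewrite subKr wE exprMn idealMr.
Qed.

Lemma separating_family : exists e : 'I_s -> A,
  (forall j, 1 - e j \in J j) /\
  forall j j', j != j' -> vanishes_doubly j' (e j).
Proof.
have /choice[E EP] (x : 'I_s * 'I_s) : exists e, x.1 != x.2 ->
    1 - e \in J x.1 /\ vanishes_doubly x.2 e.
  have [eq|/separating_pair[e eP]] := eqVneq x.1 x.2; last by exists e.
  by exists 0.
exists (fun j => \prod_(j' | j != j') E (j, j')); split=> [j|j j' ne].
  elim/big_rec: _ => [|j' e ne IH]; first by rewrite subrr idealr0.
  have [E1 _] := EP (j, j') ne.
  rewrite (_ : _ - _ = (1 - e) + e * (1 - E (j, j'))); last by ring.
  by rewrite rpredD // idealMr.
rewrite (bigD1 j') //=; apply: ideal_predMr; first exact: vanishes_doubly_ideal.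
by have [_] := EP (j, j') ne.
Qed.

(** * Differentiation and integration modulo box ideals *)

(* The box of standard monomials of A/<X^k>, for o = None, and of
   A/<X^k, k_i X_i^(k_i - 1)>, for o = Some i. *)
Definition kbox j (o : option 'I_n) i : nat :=
  (k i j - ((o == Some i) && ~~ (p %| k i j)%N))%N.

Lemma kbox_le j o i : (kbox j o i <= k i j)%N.
Proof. exact: leq_subr. Qed.

Lemma box_kbox j o (f : A) : box_ideal (k^~ j) f -> box_ideal (kbox j o) f.
Proof. exact/box_ideal_sub/kbox_le. Qed.

(** The coefficient at [m] of the derivative is [m i + 1] times the one at [m + U_(i)]. For [m] in
    the smaller box, [m + U_(i)] leaves the large box only if [m i + 1 = k i j] and [p] divides this
    number, and then the factor vanishes in [K]. *)
Lemma box_mderiv j i (f : A) :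
  box_ideal (k^~ j) f -> box_ideal (kbox j (Some i)) f^`M(i).
Proof.
move=> fk m /forallP mk; rewrite mcoeff_mderiv.
have [inb|] := boolP (in_box (k^~ j) (m + U_(i))); first by rewrite fk ?mul0rn.
rewrite negb_forall => /existsP[l]; rewrite -leqNgt mnmDE mnm1E.
have := mk l; rewrite /kbox.
have [->|ne] := eqVneq i l; last first.
  rewrite addn0 (_ : _ == _ = false) ?subn0; first by move/leq_trans => H /H; rewrite ltnn.
  by apply/eqP => -[/eqP]; rewrite (negPf ne).
rewrite eqxx addn1 /=; case: (boolP (p %| k l j)%N) => [pk|_] /=; last first.
  by rewrite subn1 => lt le; have := leq_trans le lt; rewrite leqNgt ltn_predL k_gt0.
rewrite subn0 => lt le; have -> : (m l).+1 = k l j by apply/eqP; rewrite eqn_leq lt.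
by rewrite -mulr_natr; move: pk; rewrite charK => /eqP->; rewrite mulr0.
Qed.

(** The generators other than the power of [X_i] are common to both ideals, so only a multiple of
    that power is left over. *)
Lemma box_split (k' k0 : 'I_n -> nat) i (v : A) :
  (forall l, l != i -> k' l = k0 l) -> box_ideal k' v ->
  exists h, box_ideal k0 (v - h * 'X_i ^+ k' i).
Proof.
move=> ext /box_ideal_generated; have [B0 BD BM] := box_idealP K k0.
apply: (@ideal_generated_sub _ _ (fun v => exists h, box_ideal k0 (v - h * 'X_i ^+ k' i))).
  split=> [|u w [h uh] [g wg]|c u [h uh]].
  - by exists 0; rewrite mul0r subr0.
  - exists (h + g); rewrite (_ : _ - _ = (u - h * 'X_i ^+ k' i) + (w - g * 'X_i ^+ k' i)).
      exact: BD.
    by ring.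
  - by exists (c * h); rewrite -mulrA -mulrBr; apply: BM.
move=> _ [l ->]; have [->|ne] := eqVneq l i.
  by exists 1; rewrite mul1r subrr.
by exists 0; rewrite mul0r subr0 ext //; apply: box_ideal_power.
Qed.

(** If [p] divides [k i j], both boxes agree and [G = 0] works. Otherwise [v] is [h X_i^(k - 1)]
    modulo the ideal, and [G = h X_i^k / k] works: derivatives of [h] enter only with the factor
    [X_i^k]. *)
Lemma box_antiderivative1 j i (v : A) : box_ideal (kbox j (Some i)) v ->
  exists G, box_ideal (k^~ j) G /\
    forall l, box_ideal (k^~ j) (G^`M(l) - (i == l)%:R * v).
Proof.
have BI := box_idealP K (k^~ j); have [B0 BD BM] := BI.
move=> vk; have [pk|pk] := boolP (p %| k i j)%N.
  have vk' : box_ideal (k^~ j) v.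
    move=> m /forallP mk; apply: vk; apply/forallP => l.
    rewrite /kbox; case: eqP => [[<-]|_]; rewrite ?pk subn0; exact: mk.
  exists 0; split=> // l; rewrite mderiv0 sub0r.
  by apply: ideal_predN BI _; apply: BM.
have kE : kbox j (Some i) i = (k i j).-1 by rewrite /kbox eqxx pk subn1.
have [|h] := @box_split _ (k^~ j) i v _ vk.
  by move=> l ne; rewrite /kbox; case: eqP => [[E]|_]; [rewrite E eqxx in ne|rewrite subn0].
rewrite kE => hv; set X : A := 'X_i; set e := (k i j).-1 in hv.
have ke : k i j = e.+1 by rewrite /e prednK.
have Xk : box_ideal (k^~ j) (X ^+ e.+1) by rewrite -ke; apply: box_ideal_power.
have kK : (k i j)%:R != 0 :> K by rewrite -charK.
pose c : A := ((k i j)%:R^-1)%:MP.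
have cE : c * (e.+1)%:R = 1.
  by rewrite /c -ke -(mpolyC_nat n K) -mpolyCM mulVf.
exists (c * h * X ^+ e.+1); split=> [|l]; first exact: BM.
rewrite mderivM mderivXn mderivXU.
rewrite (_ : _ - _ = (c * h)^`M(l) * X ^+ e.+1 +
   - ((i == l)%:R * (v - (c * e.+1%:R) * (h * X ^+ e)))); last by ring.
apply: BD; first exact: BM.
by rewrite cE mul1r; apply: ideal_predN BI _; apply: BM.
Qed.

Lemma box_antiderivative j (v : 'I_n -> A) :
  (forall i, box_ideal (kbox j (Some i)) (v i)) ->
  exists G, box_ideal (k^~ j) G /\ forall l, box_ideal (k^~ j) (G^`M(l) - v l).
Proof.
move=> /(_ _)/box_antiderivative1-/choice[G GP].
have BI := box_idealP K (k^~ j).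
exists (\sum_i G i); split.
  by apply: ideal_pred_sum => // i _ _; case: (GP i).
move=> l; rewrite raddf_sum /=.
rewrite (_ : _ - _ = \sum_i ((G i)^`M(l) - (i == l)%:R * v i)).
  by apply: ideal_pred_sum => // i _ _; case: (GP i).
rewrite sumrB; congr (_ - _); rewrite (bigD1 l) //= eqxx mul1r big1 ?addr0 //.
by move=> i /negPf ->; rewrite mul0r.
Qed.

Lemma jacobian_inverse j (u : 'I_n -> A) l :
  \sum_i (b j i l)%:MP * (\sum_l' (a j l' i)%:MP * u l') = u l.
Proof.
under eq_bigr => i _ do rewrite mulr_sumr.
rewrite exchange_big /= (eq_bigr (fun l' => (l' == l)%:R * u l')) => [|l' _].
  rewrite (bigD1 l) //= eqxx mul1r big1 ?addr0 // => i /negPf ->.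
  by rewrite mul0r.
rewrite -mpolyC_nat -(ab j) rmorph_sum mulr_suml; apply: eq_bigr => i _.
by rewrite /= mpolyCM; ring.
Qed.

(** The hypothesis concerns the coefficients of the form [rho] in the coordinates of [phi j]. They
    are integrated there, and the inverse Jacobian [b] turns the gradient back. *)
Lemma local_potential j (rho : 'I_n -> A) :
  (forall i, box_ideal (kbox j (Some i))
               (\sum_l (a j l i)%:MP * phi j (rho l))) ->
  exists g, g \in J j /\ forall l, g^`M(l) - rho l \in J j.
Proof.
move=> /box_antiderivative[G [Gk dG]]; exists (psi j G); split.
  by apply/memJ; rewrite psiK.
move=> l; apply/memJ; rewrite -[X in box_ideal _ X](jacobian_inverse j
  (fun l => phi j ((psi j G)^`M(l) - rho l)) l).
have BI := box_idealP K (k^~ j).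
apply: ideal_pred_sum => // i _ _; case: BI => _ _; apply.
rewrite (_ : \sum_l' _ = G^`M(i) - \sum_l' (a j l' i)%:MP * phi j (rho l')) //.
rewrite -{2}[G](psiK j) grad_phi -sumrB; apply: eq_bigr => l' _.
by rewrite rmorphB mulrBr.
Qed.

(** The local potentials are glued by the functions [e j]: as these vanish doubly at the other
    points, foreign summands do not affect the gradient modulo [J j]. *)
Lemma global_potential (rho : 'I_n -> A) :
  (forall j i, box_ideal (kbox j (Some i))
               (\sum_l (a j l i)%:MP * phi j (rho l))) ->
  exists g, forall j, g \in J j /\ forall l, g^`M(l) - rho l \in J j.
Proof.
move=> /(_ _)/local_potential-/choice[g gP].
have [e [e1 e0]] := separating_family.
exists (\sum_j e j * g j) => j; split.
  apply: rpred_sum => j' _; have [<-|ne] := eqVneq j' j.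
    by apply: idealMr; case: (gP j').
  by rewrite mulrC idealMr //; case: (e0 _ _ ne).
move=> l; rewrite raddf_sum /= (bigD1 j) //= addrAC rpredD //; last first.
  apply: rpred_sum => j' ne; have [eJ dJ] := e0 _ _ ne.
  by rewrite mderivM rpredD // mulrC idealMr.
have [gJ dg] := gP j; rewrite mderivM.
(* The term with the derivative of [e j] is harmless because [g j] lies in [J j]. *)
rewrite (_ : _ - _ = (e j)^`M(l) * g j +
  (((g j)^`M(l) - rho l) - (g j)^`M(l) * (1 - e j))); last by ring.
by apply: rpredD; [exact: idealMr|apply: rpredB => //; exact: idealMr].
Qed.

(** * Linear functionals on differential forms *)

(** The coefficients of a vector field: the Euler field for [None], and for [Some i] the field that
    becomes [d/dX_i] in the coordinates of [phi j]. *)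
Definition form_coef j (o : option 'I_n) (l : 'I_n.+1) : P :=
  if o is Some i then
    if unlift ord0 l is Some l' then (a j l' i)%:MP else 0
  else 'X_l.

Definition local_form j o (rho : 'I_n.+1 -> A) : A :=
  phi j (\sum_l dehomog (form_coef j o l) * rho l).

Lemma local_form_None j rho : local_form j None rho =
  phi j (rho ord0 + \sum_i 'X_i * rho (fintype.lift ord0 i)).
Proof.
rewrite /local_form big_ord_recl /= dehomog_X0 mul1r.
by congr (phi j (_ + _)); apply: eq_bigr => i _; rewrite dehomog_lift.
Qed.

Lemma local_form_Some j i rho : local_form j (Some i) rho =
  \sum_l (a j l i)%:MP * phi j (rho (fintype.lift ord0 l)).
Proof.
rewrite /local_form big_ord_recl /= unlift_none rmorph0 mul0r add0r rmorph_sum.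
by apply: eq_bigr => l _; rewrite /= ?liftK lrmorphC rmorphM /= lrmorphC.
Qed.

Lemma local_form_lincomb (T : finType) j o (c : T -> K) r rho :
  local_form j o (fun l => r l - \sum_t (c t)%:MP * rho t l) =
  local_form j o r - \sum_t (c t)%:MP * local_form j o (rho t).
Proof.
rewrite /local_form (eq_bigr (fun l => dehomog (form_coef j o l) * r l -
  \sum_t (c t)%:MP * (dehomog (form_coef j o l) * rho t l))); last first.
  move=> l _; rewrite mulrBr mulr_sumr; congr (_ - _).
  by apply: eq_bigr => t _; rewrite mulrCA.
rewrite sumrB rmorphB exchange_big [X in _ - X]rmorph_sum /=; congr (_ - _).
by apply: eq_bigr => t _; rewrite -mulr_sumr rmorphM /= lrmorphC.
Qed.

Lemma local_form_dehomog j o r : local_form j o (fun l => dehomog (r l)) =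
  phi j (dehomog (\sum_l form_coef j o l * r l)).
Proof.
rewrite /local_form [dehomog (\sum_l _)]rmorph_sum; congr (phi j _).
by apply: eq_bigr => l _; rewrite -rmorphM.
Qed.

Lemma dehomog_memJ f j : f \in I -> dehomog f \in J j.
Proof. by move=> fI; move: j; apply/IJ; exists f. Qed.

Lemma euler_mem f : f \in I -> \sum_l 'X_l * f^`M(l) \in I.
Proof.
move=> fI; rewrite [f](pihomog_partitionE (leqnn (msize f))).
under eq_bigr => l _ do rewrite raddf_sum mulr_sumr.
rewrite exchange_big; apply: rpred_sum => d _.
by rewrite (euler_homog (pihomogP mdeg d f)); apply/idealMr/Ih.
Qed.

(** The Euler field maps [I] into itself, and the [i]-th local field maps it into the smaller box
    ideal by [box_mderiv], so both respect the relations between the [dX_l]. *)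
Lemma omega_eq0_local r j o : omega I r = 0 ->
  box_ideal (kbox j o) (local_form j o (fun l => dehomog (r l))).
Proof.
pose U (f : P) := box_ideal (kbox j o) (phi j (dehomog f)).
have UI : ideal_pred U.
  apply: (@ideal_pred_preim _ _ (@dehomog K n)
           (fun g => box_ideal (kbox j o) (phi j g))).
  exact: ideal_pred_preim (box_idealP _ _).
have IU f : f \in I -> U f by move=> fI; apply/box_kbox/memJ/dehomog_memJ.
move=> /(omega_eq0_test (c := form_coef j o) UI IU) H.
suff: U (\sum_l form_coef j o l * r l).
  by rewrite local_form_dehomog.
apply: H => f fI; case oE: o => [i|]; last exact/IU/euler_mem.
rewrite /U -oE -local_form_dehomog oE local_form_Some.
under eq_bigr => l _ do rewrite -mderiv_dehomog.
by rewrite -grad_phi; apply/box_mderiv/memJ/dehomog_memJ.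
Qed.

(** The potential [g] of the coefficients other than the one of [dX_0] lifts to a form [f] in [I].
    After scaling by a power of [X_0], [r] minus the gradient of [f] dehomogenizes into every [J j],
    so a further power moves it into [I], while [df = 0]. *)
Lemma omega_torsion d r : (forall l, r l \is d.-homog) ->
  (forall j o, box_ideal (kbox j o) (local_form j o (fun l => dehomog (r l)))) ->
  exists L, coord_proj I 'X_ord0 ^+ L *: omega I r = 0.
Proof.
move=> rd r0.
have [|g gP] := global_potential (rho := fun i => dehomog (r (fintype.lift ord0 i))).
  by move=> j i; rewrite -(local_form_Some j i (fun l => dehomog (r l))).
have u0 j : dehomog (r ord0) +
    \sum_i 'X_i * dehomog (r (fintype.lift ord0 i)) \in J j.
  apply/memJ; have := r0 j None; rewrite local_form_None.
  by apply: box_ideal_sub => i; rewrite /kbox subn0.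
have [f0 f0I gE] : dehomog_ideal I g by apply/IJ => j; case: (gP j).
(* The common degree of the multiples of the [r l] and of the partial derivatives of the lift. *)
pose D := (d + msize f0)%N.
have [|f [fI fD fE]] := @homogeneous_lift _ _ I D.+1 f0 Ih f0I.
  by rewrite leqW // leq_addl.
rewrite {}gE in fE; pose X0 : P := 'X_ord0.
pose u l := X0 ^+ (msize f0) * r l - f^`M(l).
have X0e e : X0 ^+ e \is e.-homog.
  by rewrite -[X in X.-homog]mul1n; apply/dhomogMn/homogX.
have ud l : u l \is D.-homog.
  apply: rpredB; last exact: mderiv_homog.
  by rewrite /D addnC; apply: dhomogM.
have X0r l : dehomog (X0 ^+ (msize f0) * r l) = dehomog (r l).
  by rewrite rmorphM rmorphXn /= dehomog_X0 expr1n mul1r.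
have uJ l j : dehomog (u l) \in J j.
  have [gJ dg] := gP j; rewrite rmorphB /= X0r.
  have dl i : dehomog (u (fintype.lift ord0 i)) \in J j.
    by rewrite rmorphB /= X0r -mderiv_dehomog fE -opprB rpredN.
  case: (unliftP ord0 l) => [i|] ->; first by have := dl i; rewrite rmorphB /= X0r.
  (* Euler's formula at [X_0 = 1] recovers the derivative along [X_0] from the others. *)
  have E : dehomog f^`M(ord0) +
      \sum_i 'X_i * dehomog f^`M(fintype.lift ord0 i) = D.+1%:R * g.
    have := congr1 (@dehomog K n) (euler_homog fD).
    rewrite [in RHS]rmorphM rmorph_nat /= fE => <-.
    rewrite big_ord_recl rmorphD rmorphM /= dehomog_X0 mul1r; congr (_ + _).
    rewrite [RHS]rmorph_sum.
    by apply: eq_bigr => i _; rewrite rmorphM /= dehomog_lift.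
  have -> : dehomog f^`M(ord0) = D.+1%:R * g -
      \sum_i 'X_i * (dehomog (r (fintype.lift ord0 i))) +
      \sum_i 'X_i * dehomog (u (fintype.lift ord0 i)).
    rewrite -E -addrA [X in _ + X]addrC -sumrN -[LHS]addr0 -!addrA; congr (_ + _).
    rewrite -!big_split big1 // => i _ /=.
    by rewrite [dehomog (u _)]rmorphB /= X0r; ring.
  rewrite (_ : _ - _ = (dehomog (r ord0) +
    \sum_i 'X_i * dehomog (r (fintype.lift ord0 i))) - (D.+1%:R * g +
      \sum_i 'X_i * dehomog (u (fintype.lift ord0 i)))); last by ring.
  apply: rpredB; first exact: u0.
  apply: rpredD; first exact: idealMr.
  by apply: rpred_sum => i _; apply: idealMr.
have /choice[L LP] l : exists e, X0 ^+ e * u l \in I.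
  have [h hI hE] : dehomog_ideal I (dehomog (u l)) by apply/IJ => j.
  exact: homogeneous_dehomog_mem Ih hI (ud l) (esym hE).
exists (\sum_l L l + msize f0)%N; rewrite exprD -scalerA -!rmorphXn -!omegaM.
transitivity (omega I (fun l => X0 ^+ (\sum_l L l) * f^`M(l))).
  apply: eq_omega => l; rewrite -mulrBr (bigD1 l) //= exprD mulrAC mulrC.
  by apply: idealMr; apply: LP.
by rewrite omegaM omega_grad_eq0 // scaler0.
Qed.

(** Modulo [J j'] the factor [e j] acts as the Kronecker symbol, while [psi j] and [b j] undo the
    local coordinates. *)
Lemma local_form_dual j o m : exists rho, forall j' o',
  box_ideal (kbox j' o')
    (local_form j' o' rho - ((j' == j) && (o' == o))%:R * 'X_[m]).
Proof.
have [e [e1 e0]] := separating_family.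
have key j' (q f : A) : box_ideal (k^~ j') (f - phi j' (e j) * q) ->
    box_ideal (k^~ j') (f - (j' == j)%:R * q).
  move=> fq; have BI := box_idealP K (k^~ j'); have [_ BD BM] := BI.
  rewrite (_ : f - _ = (f - phi j' (e j) * q) + q * (phi j' (e j) - (j' == j)%:R)); last by ring.
  apply: BD => //; apply: BM; have [->|ne] := eqVneq j' j.
    rewrite -[_ - _]opprB; apply: ideal_predN (box_idealP _ _) _.
    by have /memJ := e1 j; rewrite rmorphB rmorph1.
  by rewrite subr0; apply/memJ; case: (e0 j j') => //; rewrite eq_sym.
have B0 j' : box_ideal (k^~ j') (0 : A) by move=> m' _; exact: mcoeff0.
case: o => [i|]; last first.
  exists (fun l => if unlift ord0 l is Some _ then 0 else e j * psi j 'X_[m]).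
  move=> j' [i'|].
    rewrite local_form_Some andbF mul0r subr0 big1 => [|l _]; first exact: box_kbox.
    by rewrite liftK rmorph0 mulr0.
  rewrite andbT local_form_None unlift_none big1 ?addr0 => [|l _]; last first.
    by rewrite liftK mulr0.
  apply: box_kbox; rewrite rmorphM; have [->|ne] := eqVneq j' j.
    have := key j 'X_[m] (phi j (e j) * 'X_[m]); rewrite subrr eqxx /= psiK.
    by apply; apply: B0.
  rewrite mul0r subr0; apply: ideal_predMr (box_idealP _ _) _.
  by apply/memJ; case: (e0 j j') => //; rewrite eq_sym.
pose v l := e j * psi j ((b j i l)%:MP * 'X_[m]).
(* The coefficient of [dX_0] makes the contraction with the Euler field vanish. *)
exists (fun l => if unlift ord0 l is Some l' then v l' else - \sum_l' 'X_l' * v l').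
move=> j' [i'|]; last first.
  rewrite local_form_None andbF mul0r subr0 unlift_none.
  under [X in _ + X]eq_bigr => l _ do rewrite /= liftK.
  by rewrite addNr rmorph0; apply: box_kbox.
apply: box_kbox; rewrite local_form_Some.
under eq_bigr => l _ do rewrite /= liftK.
have [->|ne] := eqVneq j' j; last first.
  rewrite mul0r subr0; apply: ideal_pred_sum (box_idealP _ _) _ => l _ _.
  have [_ _ BM] := box_idealP K (k^~ j'); apply: (BM); rewrite rmorphM.
  apply: ideal_predMr (box_idealP _ _) _.
  by apply/memJ; case: (e0 j j') => //; rewrite eq_sym.
have -> : \sum_l (a j l i')%:MP * phi j (v l) =
    phi j (e j) * ((Some i' == Some i)%:R * 'X_[m]).
  under eq_bigr => l _ do rewrite rmorphM /= psiK.
  rewrite -mpolyC_nat eq_sym -(_ : (i == i')%:R = (Some i == Some i')%:R :> K) //.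
  rewrite -(ba j) rmorph_sum mulr_suml mulr_sumr; apply: eq_bigr => l _.
  by rewrite /= mpolyCM; ring.
have := key j ((Some i' == Some i)%:R * 'X_[m])
  (phi j (e j) * ((Some i' == Some i)%:R * 'X_[m])).
by rewrite subrr eqxx mul1r; apply; apply: B0.
Qed.

(** * Counting standard monomials and the dimension of a component *)

(** Exponents below [B] form a finite type, so standard monomials can be counted and can index a
    basis. *)
Definition mnm_of_ffun (B : nat) (q : {ffun 'I_n -> 'I_B}) : 'X_{1..n} :=
  [multinom (q i : nat) | i < n].

Definition box_indices (B : nat) : {set 'I_s * option 'I_n * {ffun 'I_n -> 'I_B}} :=
  [set t : 'I_s * option 'I_n * {ffun 'I_n -> 'I_B} |
    in_box (kbox t.1.1 t.1.2) (mnm_of_ffun t.2)].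

Lemma card_box_indices B : (forall i j, (k i j <= B)%N) ->
  #|box_indices B| = (\sum_j \sum_o \prod_i kbox j o i)%N.
Proof.
move=> kB; rewrite -sum1dep_card.
rewrite -(pair_big_dep predT
  (fun (x : 'I_s * option 'I_n) (q : {ffun 'I_n -> 'I_B}) =>
     in_box (kbox x.1 x.2) (mnm_of_ffun q)) (fun _ _ => 1%N)) /=.
rewrite -(pair_bigA _ (fun j o => \sum_(q : {ffun 'I_n -> 'I_B} |
  in_box (kbox j o) (mnm_of_ffun q)) 1)%N) /=.
apply: eq_bigr => j _; apply: eq_bigr => o _; rewrite sum1dep_card.
transitivity #|(family (fun i => [pred y : 'I_B | (y < kbox j o i)%N]) :
                 simpl_pred {ffun 'I_n -> 'I_B})|.
  apply: eq_card => q; rewrite inE; apply/forallP/familyP => H i.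
    by have := H i; rewrite mnmE.
  by have := H i; rewrite mnmE.
rewrite card_family foldrE big_map big_enum /=; apply: eq_bigr => i _.
have le : (kbox j o i <= B)%N by apply: leq_trans (kbox_le _ _ _) (kB _ _).
by rewrite -sum1_card (big_ord_narrow le) sum1_card card_ord.
Qed.

(** The functionals [Fn] are dual to the forms [bas], hence independence. For spanning, subtracting
    the combination with coefficients [Fn x r] leaves a form on which all functionals vanish; it is
    torsion, hence zero. *)
Lemma Omega1_dimension N :
  (forall d f, (N <= d)%N -> f \is d.+1.-homog ->
    exists2 g : P, g \is d.-homog & f - 'X_ord0 * g \in I) ->
  exists d0, forall d, (d0 <= d)%N ->
    has_dimension (coord_const I) (@Omega1_component K n I d)
      (\sum_j \sum_o \prod_i kbox j o i).
Proof.
move=> onto; have [d1 torsion_free] := omega_torsion_free onto.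
pose B := (\sum_i \sum_j k i j).+1.
have kB i j : (k i j < B)%N.
  by rewrite ltnS (bigD1 i) //= (bigD1 j) //= -addnA leq_addr.
have /choice[rho rhoP] (t : 'I_s * option 'I_n * {ffun 'I_n -> 'I_B}) :=
  local_form_dual t.1.1 t.1.2 (mnm_of_ffun t.2).
(* The sum bounds the sizes of all [rho t l], which can thus be homogenized to degree [e = d - 1];
   the successor excludes [d = 0]. *)
exists (maxn d1 (\sum_t \sum_l msize (rho t l)).+1) => -[|e] le.
  by move: le; rewrite leqn0 -leqn0 geq_max andbF.
move: le; rewrite geq_max ltnS => /andP[le1 le2].
rewrite -(@card_box_indices B) => [|i j]; last exact: ltnW.
set S := box_indices B.
pose R (x : 'I_#|S|) l : P := homogenize e (rho (enum_val x) l).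
have Rhomog x l : R x l \is e.-homog.
  apply: homogenize_homog; apply: leq_trans (leqW le2).
  by rewrite (bigD1 (enum_val x)) //= (bigD1 l) //= -addnA leq_addr.
pose comb (c : 'I_#|S| -> K) l := \sum_x (c x)%:MP * R x l.
have comb_homog c l : comb c l \is e.-homog.
  apply: rpred_sum => x _; rewrite -[e]add0n.
  by apply: dhomogM => //; apply: homog_mpolyC.
pose bas x := omega I (R x).
have combE c : omega I (comb c) = \sum_x coord_const I (c x) *: bas x.
  by rewrite omega_sum; apply: eq_bigr => x _; rewrite omegaM.
have sub_combE c r : omega I (fun l => r l - comb c l) =
    omega I r - \sum_x coord_const I (c x) *: bas x.
  apply/eqP; rewrite eq_sym subr_eq -combE -omegaD; apply/eqP.
  by apply: eq_omega => l; rewrite subrK subrr idealr0.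
pose Fn (x : 'I_#|S|) r := (local_form (enum_val x).1.1 (enum_val x).1.2
  (fun l => dehomog (r l)))@_(mnm_of_ffun (enum_val x).2).
have coefE c r x : Fn x (fun l => r l - comb c l) = Fn x r - c x.
  rewrite /Fn; set y := enum_val x.
  rewrite (_ : (fun l => dehomog (r l - comb c l)) = fun l => dehomog (r l) -
    \sum_x (c x)%:MP * rho (enum_val x) l); last first.
    apply: funext => l; rewrite rmorphB rmorph_sum; congr (_ - _).
    apply: eq_bigr => z _; rewrite rmorphM /= homogenizeK; congr (_ * _).
    exact: lrmorphC.
  rewrite local_form_lincomb raddfB raddf_sum /=; congr (_ - _).
  have inb : in_box (kbox y.1.1 y.1.2) (mnm_of_ffun y.2).
    by have := enum_valP x; rewrite -/y inE.
  have pairing z : (local_form y.1.1 y.1.2 (rho (enum_val z)))@_(mnm_of_ffun y.2)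
      = (z == x)%:R.
    have := rhoP (enum_val z) y.1.1 y.1.2 _ inb; rewrite raddfB /= => /subr0_eq ->.
    rewrite -mpolyC_nat mcoeffCM mcoeffX -natrM mulnb; congr (nat_of_bool _)%:R.
    apply/andP/eqP => [[/andP[/eqP E1 /eqP E2] /eqP E3]|->]; last by rewrite !eqxx.
    apply: enum_val_inj; rewrite -/y; move: E1 E2 E3.
    case: (enum_val z) => [[j o] q]; case: y {inb} => [[j' o'] q'] /= -> -> E3.
    congr (_, _); apply/ffunP => i; apply: val_inj => /=.
    by move/mnmP/(_ i): E3; rewrite !mnmE.
  rewrite (bigD1 x) //= mcoeffCM pairing eqxx mulr1 big1 ?addr0 // => z ne.
  by rewrite mcoeffCM pairing (negPf ne) mulr0.
exists bas; split=> [w|c c0 x]; last first.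
  have := coefE c (fun=> 0) x.
  have Fn0 r : omega I r = 0 -> Fn x r = 0.
    by move=> /omega_eq0_local; apply; have := enum_valP x; rewrite inE.
  rewrite !Fn0 ?omega0 //; last by rewrite sub_combE omega0 c0 subrr.
  by rewrite sub0r => /eqP; rewrite eq_sym oppr_eq0 => /eqP.
split=> [[r rd wE]|[c ->]]; last first.
  rewrite -combE; exact: Omega1_component_omega (comb_homog c).
exists (fun x => Fn x r); apply/subr0_eq; rewrite wE -/(omega I r) -sub_combE.
have rd' l : r l - comb (Fn^~ r) l \is e.-homog.
  by apply: rpredB; [exact: rd|exact: comb_homog].
have [|L] := @omega_torsion _ _ rd'.
  (* Every monomial of a box occurs as an index, since [B] exceeds all [k i j]. *)
  move=> j o m inb.
  have mB i : (m i < B)%N.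
    by apply: leq_trans (forallP inb i) _; apply: leq_trans (kbox_le _ _ _) (ltnW _).
  pose y := (j, o, [ffun i => Ordinal (mB i)]) : 'I_s * option 'I_n * {ffun 'I_n -> 'I_B}.
  have ym : (mnm_of_ffun y.2) = m.
    by apply/mnmP => i; rewrite mnmE ffunE.
  have yS : y \in S by rewrite inE ym.
  have := coefE (Fn^~ r) r (enum_rank_in yS y).
  by rewrite /Fn enum_rankK_in // ym subrr.
apply: (torsion_free _ _ _ le1); exact: Omega1_component_omega rd'.
Qed.

(** Shortening side [i] by one removes a slice with as many points as the product of the other
    sides; this happens only for [Some i] with [p] not dividing [k i j]. *)
Lemma kbox_sum j :
  ((\sum_o \prod_i kbox j o i)%N%:R = (n.+1 * \prod_i k i j)%N%:R
    - \sum_(i < n | ~~ (p %| k i j)%N) (\prod_(i' < n | i' != i) k i' j)%N%:R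
   :> rat)%R.
Proof.
have sum_option (F : option 'I_n -> nat) :
    (\sum_o F o = F None + \sum_i F (Some i))%N.
  rewrite (bigD1 None) //=; congr (_ + _)%N.
  rewrite (reindex_omap Some id) /=; last by case.
  by apply: eq_bigl => i; rewrite eqxx.
rewrite sum_option natrD mulSn natrD -addrA; congr (_ + _).
  by congr (_%:R); apply: eq_bigr => i _; rewrite /kbox subn0.
apply/eqP; rewrite eq_sym subr_eq eq_sym -natr_sum -natrD; apply/eqP; congr (_%:R).
rewrite [X in (_ + X)%N]big_mkcond -big_split /=.
transitivity (\sum_(i < n) \prod_(i' < n) k i' j)%N;
  last by rewrite sum_nat_const card_ord.
apply: eq_bigr => i _; rewrite (bigD1 i) //= [RHS](bigD1 i) //=.
rewrite (eq_bigr (fun i' => k i' j)) => [|i' ne]; last first.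
  by rewrite /kbox; case: eqP => [[E]|_]; [rewrite E eqxx in ne|rewrite subn0].
rewrite /kbox eqxx; case: (p %| k i j)%N => /=; first by rewrite subn0 addn0.
by rewrite mulnBl mul1n subnK // leq_pmull.
Qed.

End LocallyMonomial.

(** * The Hilbert polynomial *)

(** The convention [p = 0] fits: 0 divides only 0, and in characteristic 0 only 0 vanishes in
    [K]. *)
Lemma has_characteristic_dvdn (K : fieldType) p m :
  has_characteristic K p -> (0 < m)%N -> (p %| m)%N = (m%:R == 0 :> K).
Proof.
rewrite /has_characteristic lt0n; case: eqP => [-> /pcharf0P K0 m0|_ Kp _].
  by rewrite dvd0n K0.
exact: dvdn_pcharf.
Qed.

Theorem proposition4p4 (K : fieldType) (p n : nat)
    (I : idealr {mpoly K[n.+1]}) (s : nat)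
    (pt : 'I_s -> prime_idealr {mpoly K[n.+1]})
    (J : 'I_s -> idealr {mpoly K[n]})
    (phi : 'I_s -> {lrmorphism {mpoly K[n]} -> {mpoly K[n]}})
    (k : 'I_n -> 'I_s -> nat) :
  perfect_field K ->
  has_characteristic K p ->
  (1 <= n)%N ->
  homogeneous_ideal I ->
  saturated_ideal I ->
  zero_dimensional I ->
  enumerates_support I pt ->
  (forall j, 'X_ord0 \notin pt j) ->
  is_primary_decomposition I pt J ->
  locally_monomial_gorenstein J ->
  (forall j, linear_change (phi j)) ->
  (forall i j, (1 <= k i j)%N) ->
  (forall j, maps_onto (phi j) (J j) (pure_powers (fun i => k i j))) ->
  Omega1_hilbert_polynomial I
    (\sum_(j < s)
       ((n.+1 * \prod_(i < n) k i j)%N%:R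
        - \sum_(i < n | ~~ (p %| k i j)%N)
            (\prod_(i' < n | i' != i) k i' j)%N%:R))%:P.
Proof.
move=> _ charK _ Ih _ dim0 enum X0_pt [_ radJ IJ] _ lin k_gt0 onto.
have [N onX0] := hyperplane_multiplication_onto Ih
  (closed_points_avoid_hyperplane Ih dim0 enum X0_pt).
have [pt_closed pt_inj _] := enum.
have pt_homog j : homogeneous_ideal (pt j) by case: (pt_closed j) => -[].
have /choice[psi psiP] j : exists psi : {lrmorphism {mpoly K[n]} -> {mpoly K[n]}},
    cancel (phi j) psi /\ cancel psi (phi j).
  by case: (lin j) => /lrmorphism_inverse.
have /choice[a /choice[b abP]] j := linear_change_jacobian (lin j).
have memJ j g : g \in J j <-> box_ideal (k^~ j) (phi j g).
  rewrite box_ideal_generated -(onto j); split=> [gJ|[f fJ]]; first by exists g.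
  by move/(can_inj (psiP j).1) <-.
have charkE i j := has_characteristic_dvdn charK (k_gt0 i j).
have [d0 dimE] := Omega1_dimension Ih pt_homog pt_inj X0_pt radJ IJ k_gt0 memJ
  (fun j => (psiP j).2) (fun j => let: And3 H _ _ := abP j in H)
  (fun j => let: And3 _ H _ := abP j in H)
  (fun j => let: And3 _ _ H := abP j in H) charkE onX0.
(* The same dimension serves every large [d], in agreement with the constant polynomial. *)
exists d0 => d /dimE dimd; exists (\sum_j \sum_o \prod_i kbox p k j o i)%N => //.
by rewrite hornerC natr_sum; apply: eq_bigr => j _; rewrite kbox_sum.
Qed.
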